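(* Let $\mathcal{P}$ be a circle packing with contact graph $\Gamma$. The kissing reflection group $G_\mathcal{P}$ has connected limit set if and only if $\Gamma$ is $2$-connected.
   Context: A circle packing is a connected finite collection of at least three (oriented) circles in $\widehat{\mathbb{C}}$ with disjoint interiors. Its contact graph has one vertex per circle and an edge between two vertices iff the circles touch. The kissing reflection group $G_{\mathcal{P}}$ is the group generated by the reflections along the circles of $\mathcal{P}$; its limit set is defined as for Kleinian groups. A graph is $k$-connected if it has more than $k$ vertices and remains connected after removing any $k-1$ vertices and their incident edges. *)

(* Defs.v *)
From HB Require Import structures.
From mathcomp Require Import all_boot all_order all_algebra.
From mathcomp Require Import complex.
From mathcomp Require Import all_classical all_reals all_analysis.
From mathcomp Require Import ring.

Set Implicit Arguments.
Unset Strict Implicit.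
Unset Printing Implicit Defensive.

Import Order.TTheory GRing.Theory Num.Theory.
Import numFieldNormedType.Exports.

Local Open Scope classical_set_scope.
Local Open Scope ring_scope.
Local Open Scope complex_scope.

(* [R[i]] carries its norm topology only through the alias [R[i]^o]; the point
   at infinity is [None]. *)
Notation riemann_sphere R := (one_point_compactification (R[i]^o)).

(* An oriented circle of the Riemann sphere, given by its Hermitian equation
     a |z|^2 + b^* z + b z^* + d = 0     (a, d real, b complex, a d < |b|^2),
   the interior being the side on which the left-hand side is negative.
   It is a Euclidean circle if a != 0 (see the lemmas below) and a line together
   with infinity if a = 0.  Two equations define the same oriented circle iff
   they differ by a positive real factor. *)
Record ocircle (R : realType) := OCircle {
  oc_a : R;
  oc_b : R[i];
  oc_d : R;
  oc_nondegenerate : (oc_a * oc_d)%:C < `|oc_b| ^+ 2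
}.

(* At infinity the sign is that of the |z|^2 coefficient of the equation. *)
Definition oc_form (R : realType) (C : ocircle R) (p : riemann_sphere R) : R[i] :=
  match p : option R[i] with
  | Some z => (oc_a C)%:C * `|z| ^+ 2
              + (Num.conj (oc_b C) * z + oc_b C * Num.conj z) + (oc_d C)%:C
  | None => (oc_a C)%:C
  end.

Definition oc_circle (R : realType) (C : ocircle R) : set (riemann_sphere R) :=
  [set p | oc_form C p = 0].

Definition oc_interior (R : realType) (C : ocircle R) : set (riemann_sphere R) :=
  [set p | oc_form C p < 0].

(* The image w of z is the solution of the polarized equation
   a w z^* + b^* w + b z^* + d = 0. *)
Definition reflection (R : realType) (C : ocircle R) (p : riemann_sphere R) :
    riemann_sphere R :=
  match p : option R[i] with
  | Some z =>
      let den := (oc_a C)%:C * Num.conj z + Num.conj (oc_b C) in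
      if den == 0 then None
      else Some (- (oc_b C * Num.conj z + (oc_d C)%:C) / den)
  | None => if oc_a C == 0 then None else Some (- oc_b C / (oc_a C)%:C)
  end.

Definition circle_packing (R : realType) (V : finType) (P : V -> ocircle R) :=
  [/\ (3 <= #|V|)%N,
      connected (\bigcup_(i in [set: V]) oc_circle (P i)) &
      trivIset [set: V] (fun i => oc_interior (P i))].

Definition contact_graph (R : realType) (V : finType) (P : V -> ocircle R) :
    rel V :=
  [rel i j | (i != j) && `[< oc_circle (P i) `&` oc_circle (P j) !=set0 >]].

Definition k_connected (k : nat) (V : finType) (e : rel V) :=
  (k < #|V|)%N /\
  forall S : {set V}, #|S| = k.-1 ->
    {in ~: S &, forall x y, connect [rel u v in ~: S | e u v] x y}.

Definition transformation_group (T : Type) (G : set (T -> T)) :=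
  [/\ G id,
      forall f g, G f -> G g -> G (f \o g) &
      forall f, G f -> exists g, [/\ G g, cancel f g & cancel g f]].

Definition kissing_reflection_group (R : realType) (V : finType)
    (P : V -> ocircle R) : set (riemann_sphere R -> riemann_sphere R) :=
  smallest (@transformation_group (riemann_sphere R))
    (range (fun i => reflection (P i))).

(* The accumulation points of all orbits. *)
Definition limit_set (T : topologicalType) (G : set (T -> T)) : set T :=
  \bigcup_(x in [set: T]) limit_point [set g x | g in G].

(* Euclidean centre and squared radius when [oc_a C != 0]. *)
Definition oc_center (R : realType) (C : ocircle R) : R[i] :=
  - oc_b C / (oc_a C)%:C.

Definition oc_radius2 (R : realType) (C : ocircle R) : R[i] :=
  (`|oc_b C| ^+ 2 - (oc_a C * oc_d C)%:C) / (oc_a C)%:C ^+ 2.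

Lemma oc_form_euclidean (R : realType) (C : ocircle R) (z : R[i]) :
  oc_a C != 0 ->
  oc_form C (Some z) = (oc_a C)%:C * (`|z - oc_center C| ^+ 2 - oc_radius2 C).
Proof.
move=> a0; have aC0 : (oc_a C)%:C != 0 by rewrite fmorph_eq0.
have conj_a : Num.conj (oc_a C)%:C = (oc_a C)%:C by exact: conjc_real.
rewrite /= /oc_radius2 /oc_center rmorphM /= !normCK rmorphB rmorphM rmorphN.
by rewrite fmorphV /= conj_a; field.
Qed.

Lemma reflection_euclidean (R : realType) (C : ocircle R) (z : R[i]) :
  oc_a C != 0 -> z != oc_center C ->
  reflection C (Some z) =
    Some (oc_center C + oc_radius2 C / Num.conj (z - oc_center C)).
Proof.
move=> a0 zc; have aC0 : (oc_a C)%:C != 0 by rewrite fmorph_eq0.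
have conj_a : Num.conj (oc_a C)%:C = (oc_a C)%:C by exact: conjc_real.
have : Num.conj (z - oc_center C) != 0 by rewrite conjC_eq0 subr_eq0.
rewrite /= /oc_radius2 /oc_center rmorphM /= normCK rmorphB rmorphM rmorphN.
rewrite fmorphV /= conj_a => hz.
have den : (oc_a C)%:C * Num.conj z + Num.conj (oc_b C) != 0.
  apply: contraNneq hz => h; rewrite -(mulrI_eq0 _ (mulfI aC0)) -h.
  by apply/eqP; field.
rewrite (negbTE den); congr Some; field; apply/andP; split=> //.
by rewrite opprK mulrC.
Qed.

Lemma reflection_center (R : realType) (C : ocircle R) :
  oc_a C != 0 -> reflection C (Some (oc_center C)) = None.
Proof.
move=> a0; have aC0 : (oc_a C)%:C != 0 by rewrite fmorph_eq0.
have conj_a : Num.conj (oc_a C)%:C = (oc_a C)%:C by exact: conjc_real.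
rewrite /= /oc_center rmorphM rmorphN fmorphV /= conj_a.
by rewrite mulrC divfK // addNr eqxx.
Qed.

(* Main.v *)
Require Import Defs.
From HB Require Import structures.
From mathcomp Require Import all_boot all_order all_algebra.
From mathcomp Require Import complex.
From mathcomp Require Import all_classical all_reals all_analysis.
From mathcomp Require Import ring lra.

(** Stereographic projection makes the points of the sphere unit vectors [x] of
    R^3, and oriented circles vectors [v = (n, t)] of R^{3,1} with
    [<v, v> = |n|^2 - t^2 = 1]: up to a positive factor the equation of the circle
    is the affine form [n.x + t] ([oc_formE]).  The reflection in [u] sends the
    circle [v] to [v - 2 <u, v> u] ([lform_mirror]), and disjointness of the
    interiors of [u] and [v] forces [<u, v> <= -1] ([disjoint_ldot]).

    A reduced word [i_1 ... i_n j] has a closed disc [r_{i_1} ... r_{i_n} D_j], and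
    the discs of longer words are nested in those of their prefixes.  They shrink
    uniformly with the length ([shrink]).  The opposite of the sum of three vectors
    of the packing is timelike and has product at least 1 with every vector of the
    packing; each further letter adds at least twice a vector of the packing to the
    vector of the word, so its product with the timelike vector is at least the
    number of letters ([height_exists]), and a large product means a small disc
    ([small_disc]).  Hence the limit set is the intersection [core] over [n] of the
    union [level n] of the discs of words of length [n + 1]: nested discs around a
    point of [core] contain points of a single orbit ([core_sub_limit]), while an
    orbit has only finitely many points outside [level n] or lies in [core]
    ([limit_sub_core]).

    Suppose the contact graph is 2-connected.  The discs of [level (n + 1)] whose word
    starts with [i] have as union the image under [r_i] of the union of those of
    [level n] whose word does not.  Tangency points are fixed by both reflections, so
    the unions for two touching circles meet; as the graph without [i] is connected,
    connectedness of these unions, and of the levels, follows by induction.  A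
    decreasing intersection of compact connected sets is connected
    ([core_connected]).

    Suppose that removing [c] splits the other circles into two classes without
    contact, with unions of discs [A] and [B].  The closed sets [A `|` r_c A] and
    [B `|` r_c B] cover [level 1]; they are disjoint because [r_c] fixes the circle
    [c] pointwise, and both meet the limit set ([two_connected_of_core]). *)

Set Implicit Arguments.
Unset Strict Implicit.
Unset Printing Implicit Defensive.

Import Order.TTheory GRing.Theory Num.Theory.
Import numFieldNormedType.Exports.

Local Open Scope classical_set_scope.
Local Open Scope ring_scope.
Local Open Scope complex_scope.

(** * Circles as Lorentz vectors *)

(** The first three coordinates are the linear part, and the last one the constant,
    of an affine form on R^3. *)
Record lorentz (R : Type) := Lorentz { lx : R; ly : R; lz : R; lw : R }.

Section Alg.
Variable R : realType.
Implicit Types (u v w : lorentz R) (p q : riemann_sphere R) (C : ocircle R).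

Definition ldot u v := lx u * lx v + ly u * ly v + lz u * lz v - lw u * lw v.

(** Multiples of one vector are written with a zero second coefficient. *)
Definition lcomb (s : R) u (t : R) v := Lorentz (s * lx u + t * lx v) (s * ly u + t * ly v)
   (s * lz u + t * lz v) (s * lw u + t * lw v).
Definition lrefl u v := lcomb 1 v (- (2 * ldot u v)) u.

Definition sqnorm (z : R[i]) : R := complex.Re z ^+ 2 + complex.Im z ^+ 2.

(** Stereographic projection onto the unit sphere, infinity being the north pole. *)
Definition sphx p : R := if p is Some z then 2 * complex.Re z / (1 + sqnorm z) else 0.
Definition sphy p : R := if p is Some z then 2 * complex.Im z / (1 + sqnorm z) else 0.
Definition sphz p : R := if p is Some z then (sqnorm z - 1) / (1 + sqnorm z) else 1.

Definition lform v p := lx v * sphx p + ly v * sphy p + lz v * sphz p + lw v.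

Lemma sqnorm_ge0 z : 0 <= sqnorm z.
Proof. by rewrite addr_ge0 // sqr_ge0. Qed.
Lemma sqnorm1_gt0 z : 0 < 1 + sqnorm z.
Proof. by rewrite ltr_wpDr // sqnorm_ge0. Qed.
Lemma sqnorm1_neq0 z : 1 + sqnorm z != 0.
Proof. by rewrite gt_eqF // sqnorm1_gt0. Qed.

Lemma sphereE p : sphx p ^+ 2 + sphy p ^+ 2 + sphz p ^+ 2 = 1.
Proof.
case: p => [z|] /=; last by ring.
have := sqnorm1_neq0 z; rewrite /sqnorm => h.
by field.
Qed.

Lemma lform_comb s u t v p : lform (lcomb s u t v) p = s * lform u p + t * lform v p.
Proof. by rewrite /lform /=; ring. Qed.
Lemma ldot_combr s u t v w : ldot w (lcomb s u t v) = s * ldot w u + t * ldot w v.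
Proof. by rewrite /ldot /=; ring. Qed.
Lemma ldotC u v : ldot u v = ldot v u.
Proof. by rewrite /ldot; ring. Qed.
Lemma ldot_combl s u t v w : ldot (lcomb s u t v) w = s * ldot u w + t * ldot v w.
Proof. by rewrite !(ldotC _ w) ldot_combr. Qed.

Definition oc_discr C : R := sqnorm (oc_b C) - oc_a C * oc_d C.
Lemma normC2E (z : R[i]) : `|z| ^+ 2 = (sqnorm z)%:C.
Proof. by case: z => x y; rewrite -add_Re2_Im2. Qed.
Lemma oc_discr_gt0 C : 0 < oc_discr C.
Proof. by have := oc_nondegenerate C; rewrite normC2E ltcR subr_gt0. Qed.

(** Dividing the equation of the circle by [1 + |z|^2] makes it affine on the unit
    sphere: [|z|^2] becomes [(1 + sphz) / 2] and [1] becomes [(1 - sphz) / 2]. *)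
Definition oc_vec C := Lorentz (complex.Re (oc_b C)) (complex.Im (oc_b C))
   ((oc_a C - oc_d C) / 2) ((oc_a C + oc_d C) / 2).

Definition pscale p : R := if p is Some z then 1 + sqnorm z else 1.
Lemma pscale_gt0 p : 0 < pscale p.
Proof. by case: p => [z|] /=; rewrite ?sqnorm1_gt0. Qed.

Lemma oc_formE C p : oc_form C p = (pscale p * lform (oc_vec C) p)%:C.
Proof.
case: p => [z|]; last by rewrite /= /lform /=; congr (_%:C); field.
rewrite /oc_form normC2E.
have h := sqnorm1_neq0 z.
have -> : pscale (Some z) * lform (oc_vec C) (Some z) =
  oc_a C * sqnorm z + 2 * (complex.Re (oc_b C) * complex.Re z + complex.Im (oc_b C) * complex.Im z) + oc_d C.
  by rewrite /lform /=; field.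
case: C => a [b1 b2] d n /=; case: z h => x y h /=.
by simpc; apply/eqP; rewrite eq_complex /=; apply/andP; split; apply/eqP; ring.
Qed.
End Alg.

(** * Reflections *)
Section Refl.
Variable R : realType.
Implicit Types (u v w : lorentz R) (p q : riemann_sphere R) (C : ocircle R).

(** On the null vector [(x, -1)] of a point the reflection is the Lorentz reflection
    in [w], followed by rescaling the last coordinate to [-1].  With denominators
    cleared this is a polynomial identity on each branch of the definition. *)
Lemma reflection_vec C p (N := oc_discr C) (w := oc_vec C) (r := reflection C p) :
  [/\ sphx r * (N + 2 * lform w p * lw w) = N * sphx p - 2 * lform w p * lx w,
      sphy r * (N + 2 * lform w p * lw w) = N * sphy p - 2 * lform w p * ly w &
      sphz r * (N + 2 * lform w p * lw w) = N * sphz p - 2 * lform w p * lz w].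
Proof.
rewrite {}/N {}/w {}/r; move: (oc_discr_gt0 C).
rewrite /oc_discr /oc_vec /lform.
case: C => a [b1 b2] d h; rewrite [sqnorm _]/sqnorm /= => N0.
case: p => [[x y]|] /=; clear h.
  have := sqnorm1_neq0 (x +i* y); rewrite /sqnorm /= => s0.
  set den := (X in X == 0).
  have denE : den = (a * x + b1) +i* (- (a * y + b2)).
    by rewrite /den; simpc; apply/eqP; rewrite eq_complex /=; apply/andP; split; apply/eqP; ring.
  rewrite denE; case: eqVneq => [/eqP|] den0.
    rewrite eq_complex /= oppr_eq0 !addr_eq0 in den0.
    case/andP: den0 => /eqP e1 /eqP e2.
    have {e1} -> : b1 = - (a * x) by rewrite e1 opprK.
    have {e2} -> : b2 = - (a * y) by rewrite e2 opprK.
    by split=> /=; field.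
  have D0 : (a * x + b1) ^+ 2 + (a * y + b2) ^+ 2 != 0.
    rewrite paddr_eq0 ?sqr_ge0 // !sqrf_eq0 -(oppr_eq0 (a * y + b2)).
    by rewrite eq_complex /= in den0.
  simpc => /=.
  have e : (- (a * y) - b2) ^+ 2 = (a * y + b2) ^+ 2 by ring.
  rewrite /sqnorm /= e; set D := (a * x + b1) ^+ 2 + _ in D0 *.
  (* The squared norm of the image: in this factored form it is visible as the
     denominator on both sides. *)
  have S0 : 1 + ((- ((b1 * x + b2 * y + d) * ((a * x + b1) / D)) -
     (- (b1 * y) + b2 * x) * ((- (a * y) - b2) / D)) ^+ 2 +
    ((b1 * x + b2 * y + d) * ((- (a * y) - b2) / D) -
     (- (b1 * y) + b2 * x) * ((a * x + b1) / D)) ^+ 2)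
   = (b1 ^+ 2 + b2 ^+ 2 - a * d + (a * (x ^+ 2 + y ^+ 2) + 2 * (b1 * x + b2 * y) + d) * (a + d) / (1 + (x ^+ 2 + y ^+ 2))) * (1 + (x ^+ 2 + y ^+ 2)) / D.
    by rewrite /D; field; apply/andP.
  have S1 := sqnorm1_neq0 ((- ((b1 * x + b2 * y + d) * ((a * x + b1) / D)) -
     (- (b1 * y) + b2 * x) * ((- (a * y) - b2) / D)) +i*
    ((b1 * x + b2 * y + d) * ((- (a * y) - b2) / D) -
     (- (b1 * y) + b2 * x) * ((a * x + b1) / D))).
  rewrite /sqnorm /= S0 in S1.
  rewrite S0.
  have S2 : (b1 ^+ 2 + b2 ^+ 2 - a * d) * (1 + (x ^+ 2 + y ^+ 2)) +
      (a * (x ^+ 2 + y ^+ 2) + 2 * (b1 * x + b2 * y) + d) * (a + d) != 0.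
    by apply: contraNneq S1 => S2; rewrite mulrDl divfK // S2 mul0r.
  by split; rewrite /D; field; rewrite s0 S2 andbT.
case: eqVneq => [->|a0] /=; first by split; field.
rewrite -fmorphV /=; simpc => /=; rewrite ?/sqnorm /=.
have s0 : a ^+ 2 + (b1 ^+ 2 + b2 ^+ 2) != 0.
  by rewrite gt_eqF // ltr_pwDl ?exprn_even_gt0 ?addr_ge0 ?sqr_ge0.
by split; field; rewrite !sqrrN s0 a0.
Qed.
End Refl.

Section Mirror.
Variable R : realType.
Implicit Types (u v w : lorentz R) (p q : riemann_sphere R) (C : ocircle R).

(** Minus the last coordinate of the Lorentz reflection in [u] of the null vector
    [(x, -1)] of [p]. *)
Definition lfactor u p := 1 + 2 * lform u p * lw u.

(** The formula of the reflection in [u] with the division by [lfactor u p] cleared;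
    reflections enter the later arguments through this formula only. *)
Definition mirrors u (r : riemann_sphere R -> riemann_sphere R) := forall p,
  [/\ sphx (r p) * lfactor u p = sphx p - 2 * lform u p * lx u,
      sphy (r p) * lfactor u p = sphy p - 2 * lform u p * ly u &
      sphz (r p) * lfactor u p = sphz p - 2 * lform u p * lz u].

Lemma sph_inj p q : sphx p = sphx q -> sphy p = sphy q -> sphz p = sphz q -> p = q.
Proof.
have h (z : R[i]) : sphz (Some z) != 1.
  rewrite /= -(subr_eq0 _ 1) (_ : _ - 1 = - 2 / (1 + sqnorm z)); last first.
    by have := sqnorm1_neq0 z => ?; field.
  by rewrite mulf_neq0 ?invr_eq0 ?sqnorm1_neq0 // oppr_eq0 pnatr_eq0.
case: p q => [z|] [z'|] //; last 2 first.
- by move=> _ _ e; have := h z; rewrite e eqxx.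
- by move=> _ _ e; have := h z'; rewrite -e eqxx.
have s0 := sqnorm1_neq0 z; have s1 := sqnorm1_neq0 z' => /= ex ey ez.
have es : 1 + sqnorm z = 1 + sqnorm z'.
  apply/invr_inj.
  have -> : (1 + sqnorm z)^-1 = (1 - (sqnorm z - 1) / (1 + sqnorm z)) / 2 by field.
  by rewrite ez; field.
rewrite es in ex ey.
have e1 : complex.Re z = complex.Re z'.
  by apply: (mulfI (x := 2)); rewrite ?pnatr_eq0 //; apply: (mulIf _ ex); rewrite invr_eq0.
have e2 : complex.Im z = complex.Im z'.
  by apply: (mulfI (x := 2)); rewrite ?pnatr_eq0 //; apply: (mulIf _ ey); rewrite invr_eq0.
by congr Some; apply/eqP; rewrite eq_complex e1 e2 !eqxx.
Qed.

Lemma cauchy3 (a b c x y z : R) :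
  (a * x + b * y + c * z) ^+ 2 <= (a ^+ 2 + b ^+ 2 + c ^+ 2) * (x ^+ 2 + y ^+ 2 + z ^+ 2).
Proof.
rewrite -subr_ge0 (_ : _ - _ = (a * y - b * x) ^+ 2 + (a * z - c * x) ^+ 2 + (b * z - c * y) ^+ 2); last by ring.
by rewrite !addr_ge0 ?sqr_ge0.
Qed.

(** With [k = n.x] the factor is [(t + k)^2 + (1 + t^2 - k^2)], and
    [k^2 <= |n|^2 = 1 + t^2] by the Cauchy-Schwarz inequality. *)
Lemma lfactor_gt0 u p : ldot u u = 1 -> 0 < lfactor u p.
Proof.
move=> u1; have := cauchy3 (lx u) (ly u) (lz u) (sphx p) (sphy p) (sphz p).
rewrite sphereE mulr1 /lfactor /lform.
have -> : lx u ^+ 2 + ly u ^+ 2 + lz u ^+ 2 = 1 + lw u ^+ 2 by rewrite -u1 /ldot; ring.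
move: (_ + _ + lz u * _) (lw u) => k t h.
have -> : 1 + 2 * (k + t) * t = (t + k) ^+ 2 + (1 + t ^+ 2 - k ^+ 2) by ring.
have [->|tk] := eqVneq k (- t); last first.
  by rewrite ltr_pwDl ?subr_ge0 // exprn_even_gt0 //= addrC addr_eq0.
by rewrite subrr sqrrN; nra.
Qed.

(** Lorentz reflections are self-adjoint: the reflection moves from the point to the
    circle. *)
Lemma lform_mirror u r v p : mirrors u r ->
  lform v (r p) * lfactor u p = lform (lrefl u v) p.
Proof.
move=> /(_ p) [hx hy hz]; rewrite /lform !mulrDl -!mulrA hx hy hz.
by rewrite /lfactor /lform /= /ldot; ring.
Qed.

Lemma lreflK u v : ldot u u = 1 -> lrefl u (lrefl u v) = v.
Proof.
move=> u1; have h : ldot u (lrefl u v) = - ldot u v by rewrite ldot_combr u1; ring.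
by rewrite {1}/lrefl h; case: v {h} => a b c d; rewrite /lcomb /=; congr Lorentz; ring.
Qed.

Lemma lform_mirror_self u r p : mirrors u r -> ldot u u = 1 ->
  lform u (r p) * lfactor u p = - lform u p.
Proof. by move=> ru u1; rewrite (lform_mirror _ _ ru) lform_comb u1; ring. Qed.

Lemma lform_eq p q : (forall v, lform v p = lform v q) -> p = q.
Proof.
move=> h; apply: sph_inj.
- by have := h (Lorentz 1 0 0 0); rewrite /lform /= !mul1r !mul0r !addr0.
- by have := h (Lorentz 0 1 0 0); rewrite /lform /= !mul1r !mul0r !addr0 !add0r.
- by have := h (Lorentz 0 0 1 0); rewrite /lform /= !mul1r !mul0r !addr0 !add0r.
Qed.

Lemma mirrorK u r : mirrors u r -> ldot u u = 1 -> involutive r.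
Proof.
move=> ru u1 p; apply: lform_eq => v.
have h1 : lfactor u (r p) * lfactor u p = 1.
  rewrite {1}/lfactor mulrDl -!mulrA (mulrC (lw u)) (mulrA (lform u _)).
  by rewrite lform_mirror_self // /lfactor; ring.
have := lform_mirror v (r p) ru; have := lform_mirror (lrefl u v) p ru.
by rewrite lreflK // => <- <-; rewrite -mulrA h1 mulr1.
Qed.

Lemma mirror_fix u r p : mirrors u r -> lform u p = 0 -> r p = p.
Proof.
move=> ru p0; apply: lform_eq => v.
have := lform_mirror v p ru; rewrite /lfactor p0 mulr0 mul0r addr0 mulr1 => ->.
by rewrite lform_comb p0 mulr0 addr0 mul1r.
Qed.

Lemma mirror_lt0 u r v p : mirrors u r -> ldot u u = 1 ->
  (lform v (r p) < 0) = (lform (lrefl u v) p < 0).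
Proof. by move=> ru u1; rewrite -(lform_mirror _ _ ru) pmulr_llt0 // lfactor_gt0. Qed.

Lemma mirror_le0 u r v p : mirrors u r -> ldot u u = 1 ->
  (lform v (r p) <= 0) = (lform (lrefl u v) p <= 0).
Proof. by move=> ru u1; rewrite -(lform_mirror _ _ ru) pmulr_lle0 // lfactor_gt0. Qed.

Definition oc_unit C := lcomb (Num.sqrt (oc_discr C))^-1 (oc_vec C) 0 (oc_vec C).

Lemma lform_unit C p : lform (oc_unit C) p = (Num.sqrt (oc_discr C))^-1 * lform (oc_vec C) p.
Proof. by rewrite lform_comb mul0r addr0. Qed.

Let sqr_sqrt_discr C : Num.sqrt (oc_discr C) ^+ 2 = oc_discr C.
Proof. by rewrite sqr_sqrtr // ltW // oc_discr_gt0. Qed.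
Let sqrt_discr_gt0 C : 0 < Num.sqrt (oc_discr C).
Proof. by rewrite sqrtr_gt0 oc_discr_gt0. Qed.

Lemma ldot_vec C : ldot (oc_vec C) (oc_vec C) = oc_discr C.
Proof. by rewrite /ldot /oc_discr /sqnorm /=; field. Qed.

Lemma ldot_unit C : ldot (oc_unit C) (oc_unit C) = 1.
Proof.
rewrite /oc_unit ldot_combr ldot_combl ldot_vec; have := lt0r_neq0 (sqrt_discr_gt0 C).
by move: (sqr_sqrt_discr C); move: (Num.sqrt _) => s <- h; field.
Qed.

Lemma oc_interiorE C p : oc_interior C p = (lform (oc_unit C) p < 0) :> Prop.
Proof.
rewrite /oc_interior /= oc_formE lform_unit ltcR; congr (is_true _).
by rewrite pmulr_rlt0 ?pscale_gt0 // pmulr_rlt0 // invr_gt0.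
Qed.

Lemma oc_circleE C p : oc_circle C p <-> lform (oc_unit C) p = 0.
Proof.
rewrite /oc_circle /= oc_formE lform_unit; split=> [[]|] /eqP.
  by rewrite mulf_eq0 gt_eqF ?pscale_gt0 //= => /eqP ->; rewrite mulr0.
by rewrite mulf_eq0 invr_eq0 gt_eqF //= => /eqP ->; rewrite mulr0.
Qed.

Lemma mirrors_reflection C : mirrors (oc_unit C) (reflection C).
Proof.
move=> p; have [hx hy hz] := reflection_vec C p.
have d0 : Num.sqrt (oc_discr C) != 0 by rewrite gt_eqF.
have e : lfactor (oc_unit C) p = (oc_discr C + 2 * lform (oc_vec C) p * lw (oc_vec C)) / oc_discr C.
  rewrite /lfactor lform_unit /=; move: (sqr_sqrt_discr C) d0.
  by move: (Num.sqrt _) => s <- d0; field.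
rewrite e !(mulrA (_ (reflection C p))) hx hy hz lform_unit /=; move: (sqr_sqrt_discr C) d0.
by move: (Num.sqrt _) => s <- d0; split; field.
Qed.

(** Reflections in auxiliary circles, outside any packing, produce the points needed
    in the study of two disjoint discs. *)
Lemma mirror_exists u : ldot u u = 1 -> exists r, mirrors u r.
Proof.
move=> u1; pose a := lw u + lz u; pose d := lw u - lz u.
have h : (a * d)%:C < `|lx u +i* ly u| ^+ 2.
  rewrite normC2E ltcR -subr_gt0 /sqnorm /=.
  by rewrite (_ : _ - _ = 1) // -u1 /a /d /ldot; ring.
exists (reflection (OCircle h)).
have := mirrors_reflection (OCircle h).
have e : oc_vec (OCircle h) = u.
  by case: u @a @d h {u1} => x y z w /= h; rewrite /oc_vec /=; congr Lorentz; field.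
rewrite /oc_unit -ldot_vec e u1 sqrtr1 invr1.
suff -> : lcomb 1 u 0 u = u by [].
by case: (u) => x y z w; rewrite /lcomb /= !mul0r !mul1r !addr0.
Qed.
End Mirror.

(** * Topology of the sphere *)
Section Top.
Variable R : realType.
Implicit Types (u v w : lorentz R) (p q : riemann_sphere R) (C : ocircle R).

Lemma ltr_norm_sqr (x e : R) : 0 < e -> (`|x| < e) = (x ^+ 2 < e ^+ 2).
Proof.
move=> e0; rewrite -(real_normK (num_real x)) ltr_pXn2r // nnegrE.
by rewrite ltW.
Qed.

Lemma ltr_normc_sqr (z : R[i]) (e : R) : 0 < e -> (`|z| < e%:C) = (sqnorm z < e ^+ 2).
Proof.
move=> e0; have e0' : 0 <= e%:C by rewrite lecR ltW.
rewrite -(ltr_pXn2r (n := 2)) ?nnegrE //.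
by rewrite normC2E -rmorphXn /= ltcR.
Qed.

(** Balls of [R[i]^o] have radii in [R[i]], but a positive complex number is real. *)
Lemma nbhs_complexP (z : R[i]^o) (A : set R[i]^o) :
  nbhs z A <-> exists2 e : R, 0 < e & forall x : R[i], sqnorm (z - x) < e ^+ 2 -> A x.
Proof.
split=> [/nbhs_ballP [e /= e0 eA]|[e e0 eA]].
  have [e1 ee] : 0 < complex.Re e /\ e = (complex.Re e)%:C.
    by case: e e0 {eA} => a b; rewrite ltcE /= => /andP[/eqP -> ].
  exists (complex.Re e) => // w h; apply: eA.
  by rewrite ee -ball_normE /= ltr_normc_sqr.
apply/nbhs_ballP; exists e%:C => /=; first by rewrite ltcR.
by move=> w; rewrite -ball_normE /= ltr_normc_sqr // => /eA.
Qed.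

Lemma continuous_Re : continuous (fun z : R[i]^o => complex.Re z).
Proof.
move=> z; apply/(@cvgrPdist_lt _ _ _ (nbhs z)) => e e0.
apply/nbhs_complexP; exists e => // w h.
rewrite /= ltr_norm_sqr //.
by apply: le_lt_trans h; case: z w => a b [c d]; rewrite /sqnorm /= lerDl sqr_ge0.
Qed.

Lemma continuous_Im : continuous (fun z : R[i]^o => complex.Im z).
Proof.
move=> z; apply/(@cvgrPdist_lt _ _ _ (nbhs z)) => e e0.
apply/nbhs_complexP; exists e => // w h.
rewrite /= ltr_norm_sqr //.
by apply: le_lt_trans h; case: z w => a b [c d]; rewrite /sqnorm /= lerDr sqr_ge0.
Qed.

(** Rules for continuity at a point, for functions given by an expression in a bound
    variable. *)
Lemma cont_at (T : topologicalType) (f : T -> R) :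
  (forall x, {for x, continuous f}) -> continuous f.
Proof. by []. Qed.

Section ContinuousAt.
Variables (T : topologicalType) (x : T).
Implicit Types f g : T -> R.

Lemma cont_cst (a : R) : {for x, continuous (fun _ : T => a)}.
Proof. exact: cvg_cst. Qed.

Lemma contD f g : {for x, continuous f} -> {for x, continuous g} ->
  {for x, continuous (fun t => f t + g t)}.
Proof. by move=> cf cg; exact: (@cvgD _ _ T (nbhs x)). Qed.

Lemma contB f g : {for x, continuous f} -> {for x, continuous g} ->
  {for x, continuous (fun t => f t - g t)}.
Proof. by move=> cf cg; exact: (@cvgB _ _ T (nbhs x)). Qed.

Lemma contM f g : {for x, continuous f} -> {for x, continuous g} ->
  {for x, continuous (fun t => f t * g t)}.
Proof. by move=> cf cg; exact: (@cvgM _ T (nbhs x)). Qed.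

Lemma contX f : {for x, continuous f} -> {for x, continuous (fun t => f t ^+ 2)}.
Proof. by move=> cf; exact: (@cvgM _ T (nbhs x) _ f f). Qed.

Lemma contV f : f x != 0 -> {for x, continuous f} ->
  {for x, continuous (fun t => (f t)^-1)}.
Proof. by move=> fx cf; exact: (@cvgV _ T (nbhs x)). Qed.
End ContinuousAt.

Lemma continuous_sqnorm : continuous (fun z : R[i]^o => sqnorm z).
Proof.
by apply: cont_at => z; apply: contD; apply: contX; [exact: continuous_Re|exact: continuous_Im].
Qed.

Lemma continuous_complex (T : topologicalType) (f g : T -> R) (x : T) :
  {for x, continuous f} -> {for x, continuous g} ->
  {for x, continuous (fun t => (f t +i* g t : R[i]^o))}.
Proof.
move=> /cvgrPdist_lt cf /cvgrPdist_lt cg A /nbhs_complexP [e e0 eA].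
have e2 : 0 < e / 2 by rewrite divr_gt0.
suff : \forall t \near x, A (f t +i* g t) by [].
near=> t; apply: eA; rewrite /sqnorm /=.
have h1 : `|f x - f t| < e / 2 by near: t; apply: cf.
have h2 : `|g x - g t| < e / 2 by near: t; apply: cg.
move: h1 h2; rewrite !ltr_norm_sqr //.
nra.
Unshelve. all: by end_near. Qed.

Lemma closed_sqnorm (B : R) : closed [set z : R[i]^o | sqnorm z <= B].
Proof.
by have /continuous_closedP h := continuous_sqnorm; exact: (h _ (@closed_le R B)).
Qed.

(** Every such [z] has its two coordinates in [[-b, b]], as [a^2 <= B] implies
    [|a| <= B + 1]. *)
Lemma compact_sqnorm (B : R) : compact [set z : R[i]^o | sqnorm z <= B].
Proof.
pose b := B + 1; pose f (xy : R * R) : R[i]^o := xy.1 +i* xy.2.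
apply: (@subclosed_compact _ _ (f @` (`[- b, b] `*` `[- b, b]))).
- exact: closed_sqnorm.
- apply: continuous_compact; last by apply: compact_setX; exact: segment_compact.
  apply: continuous_subspaceT => xy; apply: continuous_complex.
    exact: cvg_fst.
  exact: cvg_snd.
- move=> [x y] /= h; exists (x, y) => //=; rewrite /sqnorm /= in h.
  by rewrite !in_itv /= /b; split; apply/andP; split; nra.
Qed.

Definition inv_sqnorm1 p : R := if p is Some z then (1 + sqnorm z)^-1 else 0.

(** The neighbourhoods of infinity are the complements of compact sets, and the discs
    [|z|^2 <= 4 / e^2] are compact. *)
Lemma continuous_infty (f : riemann_sphere R -> R) :
  (forall p, (f None - f p) ^+ 2 <= 4 * inv_sqnorm1 p) -> {for None, continuous f}.
Proof.
move=> h; apply/(@cvgrPdist_lt _ _ _ (nbhs (None : riemann_sphere R))) => e e0.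
exists [set z : R[i]^o | sqnorm z <= 4 / e ^+ 2].
  by split; [exact: compact_sqnorm|exact: closed_sqnorm].
move=> p [[z /= /negP zB <-]|->] /=; last by rewrite subrr normr0.
rewrite -ltNge in zB.
rewrite /= ltr_norm_sqr //.
apply: le_lt_trans (h _) _ => /=.
rewrite ltr_pdivrMr ?sqnorm1_gt0 //.
rewrite ltr_pdivrMr ?exprn_gt0 // in zB.
by have : 0 < e ^+ 2 by [rewrite exprn_gt0]; nra.
Qed.

Lemma continuous_some (f : riemann_sphere R -> R) (z : R[i]^o) :
  {for z, continuous (f \o Some)} -> {for Some z, continuous f}.
Proof. by []. Qed.

Let continuous_inv_sqnorm1 (z : R[i]^o) : {for z, continuous (fun w : R[i]^o => (1 + sqnorm w)^-1)}.
Proof.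
apply: contV; first exact: sqnorm1_neq0.
by apply: contD; [exact: cont_cst|exact: continuous_sqnorm].
Qed.

Lemma continuous_sphx : continuous (@sphx R).
Proof.
case=> [z|].
  apply: continuous_some; apply: contM; last exact: continuous_inv_sqnorm1.
  by apply: contM; [exact: cont_cst|exact: continuous_Re].
apply: continuous_infty => -[z|] /=; last by rewrite subrr expr0n mulr0.
have s0 := sqnorm1_gt0 z; rewrite sub0r sqrrN expr_div_n ler_pdivrMr ?exprn_gt0 //.
rewrite (expr2 (1 + _)) mulrA mulfVK ?gt_eqF // /sqnorm; nra.
Qed.

Lemma continuous_sphy : continuous (@sphy R).
Proof.
case=> [z|].
  apply: continuous_some; apply: contM; last exact: continuous_inv_sqnorm1.
  by apply: contM; [exact: cont_cst|exact: continuous_Im].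
apply: continuous_infty => -[z|] /=; last by rewrite subrr expr0n mulr0.
have s0 := sqnorm1_gt0 z; rewrite sub0r sqrrN expr_div_n ler_pdivrMr ?exprn_gt0 //.
rewrite (expr2 (1 + _)) mulrA mulfVK ?gt_eqF // /sqnorm; nra.
Qed.

Lemma continuous_sphz : continuous (@sphz R).
Proof.
case=> [z|].
  apply: continuous_some; apply: contM; last exact: continuous_inv_sqnorm1.
  by apply: contB; [exact: continuous_sqnorm|exact: cont_cst].
apply: continuous_infty => -[z|] /=; last by rewrite subrr expr0n mulr0.
have s0 := sqnorm1_gt0 z.
have -> : 1 - (sqnorm z - 1) / (1 + sqnorm z) = 2 / (1 + sqnorm z) by field; rewrite gt_eqF.
rewrite expr_div_n ler_pdivrMr ?exprn_gt0 //.
rewrite (expr2 (1 + _)) mulrA mulfVK ?gt_eqF //; have := sqnorm_ge0 z; nra.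
Qed.

Lemma continuous_lform v : continuous (lform v).
Proof.
apply: cont_at => p; apply: contD; last exact: cont_cst.
apply: contD; last by apply: contM; [exact: cont_cst|exact: continuous_sphz].
by apply: contD; apply: contM; try exact: cont_cst; [exact: continuous_sphx|exact: continuous_sphy].
Qed.

Lemma open_lform v : open [set p | lform v p < 0].
Proof. by have /continuousP h := @continuous_lform v; exact: (h _ (@open_lt R 0)). Qed.

Lemma closed_lform v : closed [set p | lform v p <= 0].
Proof. by have /continuous_closedP h := @continuous_lform v; exact: (h _ (@closed_le R 0)). Qed.

Lemma sphere_hausdorff : hausdorff_space (riemann_sphere R).
Proof.
move=> p q /= h; apply: lform_eq => v.
apply: (@norm_hausdorff _ R).
move=> A B nA nB.
have [r [rA rB]] := h (lform v @^-1` A) (lform v @^-1` B) (continuous_lform nA) (continuous_lform nB).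
by exists (lform v r).
Qed.

Definition chord p q := (sphx p - sphx q) ^+ 2 + (sphy p - sphy q) ^+ 2 + (sphz p - sphz q) ^+ 2.

Lemma continuous_chord p : continuous (chord p).
Proof.
apply: cont_at => q; apply: contD; [apply: contD|]; apply: contX; apply: contB; try exact: cont_cst;
 first [exact: continuous_sphx|exact: continuous_sphy|exact: continuous_sphz].
Qed.

(** The chordal distance to [p] has a minimum on the compact complement of an open
    neighbourhood, positive because the coordinates separate points. *)
Lemma nbhs_chord p (U : set (riemann_sphere R)) :
  nbhs p U -> exists2 e, 0 < e & forall q, chord p q < e -> U q.
Proof.
rewrite nbhsE => -[W [oW Wp] WU].
have cC : compact (~` W).
  apply: (subclosed_compact _ (@one_point_compactification_compact _)) => //.
  exact: open_closedC.
have [W0|/set0P Wn0] := eqVneq (~` W) set0.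
  exists 1 => // q _; apply: WU; apply: contrapT => nW.
  have : (~` W) q by [].
  by rewrite W0.
have [c /= cW cmin] := compact_EVT_min Wn0 cC (continuous_subspaceT (@continuous_chord p)).
exists (chord p c) => [|q qc]; last first.
  apply: WU; apply: contrapT => nW.
  by have := cmin q; rewrite in_setE => /(_ nW); rewrite leNgt qc.
rewrite lt0r /chord; apply/andP; split; last by rewrite !addr_ge0 ?sqr_ge0.
apply: contraPneq cW => h; apply/not_notP.
suff <- : p = c by rewrite in_setE /= => /(_ (fun h => h Wp)).
move/eqP: h; rewrite !paddr_eq0 ?addr_ge0 ?sqr_ge0 // !sqrf_eq0 !subr_eq0.
by move=> /andP[/andP[/eqP h1 /eqP h2] /eqP h3]; apply: sph_inj.
Qed.

Lemma continuous_mirror u r : mirrors u r -> ldot u u = 1 -> continuous r.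
Proof.
move=> ru u1 p U /nbhs_chord [e e0 eU].
have key : continuous (fun q => chord (r p) (r q)).
  have cd : continuous (fun q => lfactor u q).
    apply: cont_at => q; apply: contD; first exact: cont_cst.
    by apply: contM; last exact: cont_cst; apply: contM; [exact: cont_cst|exact: continuous_lform].
  have aux (s : riemann_sphere R -> R) (t : R) : continuous s ->
     (forall q, s (r q) * lfactor u q = s q - 2 * lform u q * t) ->
     continuous (fun q => s (r q)).
    move=> cs hs.
    have -> : (fun q => s (r q)) = (fun q => (s q - 2 * lform u q * t) / lfactor u q).
      by apply/funext => q; rewrite -hs mulfK // gt_eqF // lfactor_gt0.
    apply: cont_at => q; apply: contM; last by apply: contV; [rewrite gt_eqF // lfactor_gt0|exact: cd].
    apply: contB; first exact: cs.
    by apply: contM; last exact: cont_cst; apply: contM; [exact: cont_cst|exact: continuous_lform].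
  have cx := aux _ _ continuous_sphx (fun q => let: And3 h _ _ := ru q in h).
  have cy := aux _ _ continuous_sphy (fun q => let: And3 _ h _ := ru q in h).
  have cz := aux _ _ continuous_sphz (fun q => let: And3 _ _ h := ru q in h).
  apply: cont_at => q; apply: contD; [apply: contD|]; apply: contX; apply: contB; try exact: cont_cst;
   first [exact: cx|exact: cy|exact: cz].
have /cvgrPdist_lt/(_ _ e0) := key p.
apply: filterS => q /=; rewrite /chord !subrr !expr0n /= !addr0 sub0r normrN => h.
by apply: eU; apply: le_lt_trans h; rewrite ler_norm.
Qed.
End Top.

(** * Connectedness of discs *)
Section Disc.
Variable R : realType.
Implicit Types (u v w : lorentz R) (p q : riemann_sphere R) (C : ocircle R).

Definition disc v : set (riemann_sphere R) := [set p | lform v p <= 0].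
Definition odisc v : set (riemann_sphere R) := [set p | lform v p < 0].

Lemma mirror_disc u r v : mirrors u r -> ldot u u = 1 ->
  disc (lrefl u v) = r @` disc v.
Proof.
move=> ru u1; have rK := mirrorK ru u1.
apply/seteqP; split=> [p|_ [p pv <-]]; rewrite /disc /=.
  by rewrite -(mirror_le0 _ _ ru) // => h; exists (r p).
by rewrite -(mirror_le0 _ _ ru) // rK.
Qed.

Lemma lform_some v (z : R[i]) : (1 + sqnorm z) * lform v (Some z) =
  (lw v + lz v) * sqnorm z + 2 * (lx v * complex.Re z + ly v * complex.Im z) + (lw v - lz v).
Proof. by rewrite /lform /=; have := sqnorm1_neq0 z => h; field. Qed.

Lemma lform_infty v : lform v None = lw v + lz v.
Proof. by rewrite /lform /=; ring. Qed.

(** A disc that avoids infinity is a Euclidean disc, with centre [- (lx v, ly v) / a]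
    and radius [1 / a]; it is a union of segments from its centre. *)
Lemma disc_connected_bounded v : ldot v v = 1 -> 0 < lform v None -> connected (disc v).
Proof.
rewrite lform_infty; set a := lw v + lz v => v1 a0.
have dE z : disc v (Some z) <->
    (a * complex.Re z + lx v) ^+ 2 + (a * complex.Im z + ly v) ^+ 2 <= 1.
  have key : a * ((1 + sqnorm z) * lform v (Some z)) =
      (a * complex.Re z + lx v) ^+ 2 + (a * complex.Im z + ly v) ^+ 2 - ldot v v.
    by rewrite lform_some /a /ldot /sqnorm; ring.
  by rewrite -subr_le0 -[X in _ <-> is_true (_ - X <= _)]v1 -key pmulr_rle0 // pmulr_rle0 // sqnorm1_gt0.
pose path (z : R[i]) (s : R) : riemann_sphere R :=
  Some ((- lx v / a + s * (complex.Re z + lx v / a)) +i* (- ly v / a + s * (complex.Im z + ly v / a))).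
have -> : disc v = \bigcup_(z in [set z | disc v (Some z)]) (path z @` `[0, 1]).
  apply/seteqP; split=> [[z|] zv|p [z /= /dE zv [s]]].
  - exists z => //; exists 1; first by rewrite /= in_itv /= ler01 lexx.
    by rewrite /path; congr Some; apply/eqP; rewrite eq_complex /=; apply/andP; split; apply/eqP; ring.
  - by move: zv; rewrite /disc /= lform_infty -/a leNgt a0.
  - rewrite /= in_itv /= => /andP[s0 s1] <-; apply/dE => /=.
    have hs (t x : R) : a * (- t / a + s * (x + t / a)) + t = s * (a * x + t) by field; rewrite gt_eqF.
    by rewrite !hs !exprMn -mulrDr mulr_ile1 // ?exprn_ge0 ?exprn_ile1 ?addr_ge0 ?sqr_ge0.
apply: bigcup_connected.
  exists (Some ((- lx v / a) +i* (- ly v / a))) => z _.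
  by exists 0; [rewrite /= in_itv /= ler01 lexx|rewrite /path !mul0r !addr0].
move=> z _; apply: connected_continuous_connected; first exact: segment_connected.
apply: continuous_subspaceT => s.
apply: (@continuous_comp _ _ _ (fun s : R => ((- lx v / a + s * (complex.Re z + lx v / a)) +i* (- ly v / a + s * (complex.Im z + ly v / a)) : R[i]^o)) (Some : R[i]^o -> riemann_sphere R)).
  by apply: continuous_complex; apply: contD; try exact: cont_cst; apply: contM; try exact: cont_cst.
exact: one_point_compactification_some_continuous.
Qed.

(** An inversion centred at a finite point outside the disc sends the disc to one that
    avoids infinity. *)
Lemma disc_connected v : ldot v v = 1 -> connected (disc v).
Proof.
move=> v1; have [|a0] := ltP 0 (lform v None); first exact: disc_connected_bounded.
have [z z0] : exists z, 0 < lform v (Some z).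
  suff [z z0] : exists z, 0 < (1 + sqnorm z) * lform v (Some z).
    by exists z; rewrite pmulr_rgt0 ?sqnorm1_gt0 in z0.
  rewrite lform_infty in a0.
  have [e|a1] := eqVneq (lw v + lz v) 0.
    have e' : lw v = - lz v by apply/eqP; rewrite -addr_eq0 e.
    have b0 : lx v ^+ 2 + ly v ^+ 2 = 1 by rewrite -v1 /ldot e'; ring.
    (* A half-plane: go far enough along its outer normal. *)
    pose s := 1 + `|lw v - lz v|.
    exists ((s * lx v) +i* (s * ly v)); rewrite lform_some e /=.
    rewrite (_ : _ + _ = 2 * s * (lx v ^+ 2 + ly v ^+ 2) + (lw v - lz v)); last by ring.
    by rewrite b0 /s; have := ler_norm (- (lw v - lz v)); rewrite normrN; have := normr_ge0 (lw v - lz v); lra.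
  (* The complement of a Euclidean disc: take the centre of that disc. *)
  exists ((- lx v / (lw v + lz v)) +i* (- ly v / (lw v + lz v))).
  rewrite lform_some /sqnorm /=.
  have -> : (lw v + lz v) * ((- lx v / (lw v + lz v)) ^+ 2 + (- ly v / (lw v + lz v)) ^+ 2) +
     2 * (lx v * (- lx v / (lw v + lz v)) + ly v * (- ly v / (lw v + lz v))) + (lw v - lz v)
    = - ldot v v / (lw v + lz v) by rewrite /ldot; field.
  by rewrite v1 mulN1r oppr_gt0 invr_lt0 lt_neqAle a1.
(* The circle of radius 1 around [z]; the reflected form takes at infinity the value of
   the equation of [v] at [z]. *)
pose u := Lorentz (- complex.Re z) (- complex.Im z) (1 - sqnorm z / 2) (sqnorm z / 2).
have u1 : ldot u u = 1 by rewrite /ldot /u /sqnorm /=; field.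
have [r ru] := mirror_exists u1.
pose v' := lrefl u v.
have v'1 : ldot v' v' = 1.
  by rewrite /v' /lrefl ldot_combr !ldot_combl v1 u1 (ldotC v u); ring.
have v'0 : 0 < lform v' None.
  rewrite (_ : lform _ _ = (1 + sqnorm z) * lform v (Some z)) ?mulr_gt0 ?sqnorm1_gt0 //.
  by rewrite lform_some lform_infty /v' /u /= /ldot /= /sqnorm; field.
rewrite -(lreflK v u1) (mirror_disc _ ru u1).
apply: connected_continuous_connected; first exact: disc_connected_bounded.
exact: continuous_subspaceT (continuous_mirror ru u1).
Qed.

Lemma sphere_connected : connected [set: riemann_sphere R].
Proof.
pose u := Lorentz 1 0 0 0 : lorentz R; pose u' := Lorentz (-1) 0 0 0 : lorentz R.
have -> : [set: riemann_sphere R] = disc u `|` disc u'.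
  apply/seteqP; split=> // p _; rewrite /disc /= /lform /= !mul0r !addr0 mul1r mulN1r oppr_le0.
  by case: (leP (sphx p) 0) => [|/ltW]; [left|right].
apply: connectedU; last 2 first.
- by apply: disc_connected; rewrite /ldot /=; ring.
- by apply: disc_connected; rewrite /ldot /=; ring.
by exists None; rewrite /disc /= /lform /= !mulr0 !mul0r !addr0.
Qed.
End Disc.

(** * Two discs with disjoint interiors *)
Section Caps.
Variable R : realType.
Implicit Types (u v w : lorentz R) (p q : riemann_sphere R) (C : ocircle R).

(** Reflecting in the circle of [w / sqrt <w, w>]. *)
Lemma reflect_spacelike w p : 0 < ldot w w ->
  exists q, exists2 k : R, 0 < k &
    forall v, lform v q * k = lform v p - 2 * lform w p * ldot w v / ldot w w.
Proof.
move=> w0; set N := ldot w w in w0 *; pose s := Num.sqrt N.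
have s0 : 0 < s by rewrite sqrtr_gt0.
have sN : N = s ^+ 2 by rewrite sqr_sqrtr // ltW.
pose u := lcomb s^-1 w 0 w.
have u1 : ldot u u = 1.
  by rewrite /u ldot_combr ldot_combl -/N sN; field; rewrite gt_eqF.
have [r ru] := mirror_exists u1.
exists (r p); exists (lfactor u p); first exact: lfactor_gt0.
move=> v; rewrite (lform_mirror _ _ ru) lform_comb /u ldot_combl lform_comb sN.
by field; rewrite gt_eqF.
Qed.

(** A form that vanishes at 0, 1, i and infinity is zero; at a point where the form is
    positive, the reflection exchanges the two sides. *)
Lemma odisc_nonempty u : ldot u u = 1 -> odisc u !=set0.
Proof.
move=> u1; have [r ru] := mirror_exists u1.
suff [p p0] : exists p, lform u p != 0.
  have [|p1] := ltP (lform u p) 0; first by exists p.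
  exists (r p); rewrite /odisc /= (mirror_lt0 _ _ ru) //.
  by rewrite lform_comb u1; lra.
apply/not_existsP => h.
have z p : lform u p = 0 by have /negP/negPn/eqP := h p.
have z0 := z None; have z1 := z (Some 0); have z2 := z (Some 1); have z3 := z (Some 'i%C).
move: z0 z1 z2 z3; rewrite /lform /= /sqnorm /=.
rewrite !(expr0n, expr1n, mulr0, mul0r, mulr1, addr0, add0r, sub0r, subrr, divr1, invr1).
move=> z0 z1 z2 z3.
have d0 : lw u = 0 by lra.
have c0 : lz u = 0 by lra.
have a0 : lx u = 0 by move: z2; rewrite d0 divff ?pnatr_eq0 //; lra.
have b0 : ly u = 0 by move: z3; rewrite d0 divff ?pnatr_eq0 //; lra.
by move/eqP: u1; rewrite /ldot a0 b0 c0 d0 !mul0r !addr0 subr0 eq_sym oner_eq0.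
Qed.

Section Pair.
Variables u v : lorentz R.
Hypotheses (u1 : ldot u u = 1) (v1 : ldot v v = 1).
Hypothesis dis : forall p, lform u p < 0 -> lform v p < 0 -> False.
Let c := ldot u v.
Let c' : ldot v u = c. Proof. by rewrite ldotC. Qed.

Lemma disjoint_ge0 p : lform u p < 0 -> 0 <= lform v p.
Proof. by move=> h; rewrite leNgt; apply/negP => /(dis h). Qed.

(** For [|<u, v>| < 1] the plane spanned by [u] and [v] is definite, so a reflection in
    a vector of that plane carries the projection of any null vector to any vector of
    the same length.  A target that is a negative multiple of [u + v] gives a point where
    both forms are negative. *)
Lemma disjoint_not_crossing : ~ (-1 < c < 1).
Proof.
move=> /andP[c0 c1].
have [p pu] := odisc_nonempty u1; have pv := disjoint_ge0 pu; rewrite /odisc /= in pu.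
set A := lform u p in pu; set a := lform v p in pv.
pose S := A + a; pose B := A - a.
have B0 : B < 0 by rewrite /B; lra.
pose K := Num.sqrt (S ^+ 2 + B ^+ 2 * (1 + c) / (1 - c)).
have c2 : 0 < 1 + c by rewrite -ltrBlDl sub0r.
have c3 : 0 < 1 - c by rewrite subr_gt0.
have K20 : 0 < S ^+ 2 + B ^+ 2 * (1 + c) / (1 - c).
  have B2 : 0 < B ^+ 2 by rewrite exprn_even_gt0 //= lt_eqF.
  by rewrite ltr_wpDl ?sqr_ge0 // (divr_gt0 (mulr_gt0 B2 c2)).
have K0 : 0 < K by rewrite sqrtr_gt0.
have KE : K ^+ 2 = S ^+ 2 + B ^+ 2 * (1 + c) / (1 - c) by rewrite sqr_sqrtr // ltW.
(* In the orthogonal basis [u + v], [u - v] the projection of [p] has coordinates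
   [S / (2 + 2 c)] and [B / (2 - 2 c)]; the target is [- K / (2 + 2 c)] times [u + v],
   and [w] is their difference. *)
pose x := (S + K) / (2 * (1 + c)); pose y := B / (2 * (1 - c)).
pose w := lcomb (x + y) u (x - y) v.
have NE : ldot w w = 2 * (1 + c) * x ^+ 2 + 2 * (1 - c) * y ^+ 2.
  by rewrite /w ldot_combr !ldot_combl u1 v1 c' -/c; ring.
have y0 : y != 0.
  by apply: mulf_neq0; rewrite ?(lt_eqF B0) // invr_eq0 mulf_neq0 ?pnatr_eq0 ?(gt_eqF c3).
have N0 : 0 < ldot w w.
  have y2 : 0 < y ^+ 2 by rewrite exprn_even_gt0.
  rewrite NE; apply: ltr_wpDl; last by apply: mulr_gt0 => //; apply: mulr_gt0.
  by apply: mulr_ge0; rewrite ?sqr_ge0 // mulr_ge0 // ltW.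
have wp : lform w p = ldot w w / 2.
  rewrite NE /w lform_comb -/A -/a.
  have -> : (x + y) * A + (x - y) * a = x * S + y * B by rewrite /S /B; ring.
  apply/eqP; rewrite -subr_eq0; apply/eqP.
  transitivity ((S ^+ 2 + B ^+ 2 * (1 + c) / (1 - c) - K ^+ 2) / (4 * (1 + c))); last by rewrite KE subrr mul0r.
  by rewrite /x /y; field; rewrite (gt_eqF c2) (gt_eqF c3).
have [q [k k0 qE]] := reflect_spacelike p N0.
have qE' z : lform z q * k = lform z p - ldot w z.
  by rewrite qE wp; field; rewrite gt_eqF.
have qu : lform u q * k = - K / 2.
  rewrite qE' ldot_combl u1 c' -/A /x /y.
  by rewrite /S /B; field; rewrite (gt_eqF c2) (gt_eqF c3).
have qv : lform v q * k = - K / 2.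
  rewrite qE' ldot_combl v1 -/c -/a /x /y.
  by rewrite /S /B; field; rewrite (gt_eqF c2) (gt_eqF c3).
by apply: (dis (p := q)); rewrite -(pmulr_llt0 _ k0) ?qu ?qv mulNr oppr_lt0 divr_gt0.
Qed.

(** For [<u, v> >= 1], reflecting in [v] a point inside [u] and outside [v] lowers the
    form [u] and makes the form [v] negative. *)
Lemma disjoint_not_nested : ~ (1 <= c).
Proof.
move=> c1.
have [p pu pv] : exists2 p, lform u p < 0 & 0 < lform v p.
  have [p pu] := odisc_nonempty u1; rewrite /odisc /= in pu.
  have := disjoint_ge0 pu; rewrite le_eqVlt => /predU1P[pv|]; last by exists p.
  (* The point found lies on the circle of [v]: push it off, keeping it inside [u]. *)
  pose w := lcomb 1 v 2^-1 u.
  have NE : ldot w w = 5 / 4 + c.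
    by rewrite /w ldot_combr !ldot_combl u1 v1 c' -/c; field.
  have N0 : 0 < ldot w w by rewrite NE; lra.
  have [q [k k0 qE]] := reflect_spacelike p N0.
  have wp : lform w p = lform u p / 2 by rewrite lform_comb -pv; field.
  exists q; [rewrite -(pmulr_llt0 _ k0) qE wp|rewrite -(pmulr_lgt0 _ k0) qE wp].
    rewrite ldot_combl c' u1 NE.
    have -> : lform u p - 2 * (lform u p / 2) * (1 * c + 2^-1 * 1) / (5 / 4 + c) =
      lform u p * ((3 / 4) / (5 / 4 + c)) by field; apply/eqP; lra.
    by rewrite pmulr_llt0 // divr_gt0; lra.
  rewrite ldot_combl v1 -/c NE -pv.
  have -> : 0 - 2 * (lform u p / 2) * (1 * 1 + 2^-1 * c) / (5 / 4 + c) =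
      (- lform u p) * ((1 + c / 2) / (5 / 4 + c)) by field; apply/eqP; lra.
  by rewrite mulr_gt0 ?oppr_gt0 // divr_gt0; lra.
have N0 : 0 < ldot v v by rewrite v1.
have [q [k k0 qE]] := reflect_spacelike p N0.
apply: (dis (p := q)); rewrite -(pmulr_llt0 _ k0) qE v1 ?c' divr1; nra.
Qed.

Lemma disjoint_ldot : c <= -1.
Proof.
rewrite leNgt; apply/negP => c0; have [c1|c1] := leP 1 c.
  exact: disjoint_not_nested c1.
by apply: disjoint_not_crossing; rewrite c0.
Qed.

(** A point of the circle [u] inside [v] would be sent inside both by the reflection in
    [v - 2 u]. *)
Lemma disjoint_on_circle p : lform u p = 0 -> 0 <= lform v p.
Proof.
move=> pu; rewrite leNgt; apply/negP => pv; have c1 := disjoint_ldot.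
pose w := lcomb 1 v (- 2) u.
have NE : ldot w w = 5 - 4 * c.
  by rewrite /w ldot_combr !ldot_combl u1 v1 c' -/c; ring.
have N0 : 0 < ldot w w by rewrite NE; lra.
have [q [k k0 qE]] := reflect_spacelike p N0.
have wp : lform w p = lform v p by rewrite lform_comb pu; ring.
apply: (dis (p := q)); rewrite -(pmulr_llt0 _ k0) qE wp NE ldot_combl ?u1 ?v1 ?c' -/c ?pu.
  have -> : 0 - 2 * lform v p * (1 * c + - 2 * 1) / (5 - 4 * c) = lform v p * (2 * (2 - c) / (5 - 4 * c)).
    by field; apply/eqP; lra.
  by rewrite pmulr_llt0 // divr_gt0; lra.
have -> : lform v p - 2 * lform v p * (1 * 1 + - 2 * c) / (5 - 4 * c) = lform v p * (3 / (5 - 4 * c)).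
  by field; apply/eqP; lra.
by rewrite pmulr_llt0 // divr_gt0; lra.
Qed.
End Pair.
End Caps.

(** * The discs of reduced words *)
Section Packing.
Variables (R : realType) (V : finType).
Local Notation T := (riemann_sphere R).
Variables (v : V -> lorentz R) (r : V -> T -> T).
Hypotheses (v1 : forall i, ldot (v i) (v i) = 1) (rv : forall i, mirrors (v i) (r i)).
Hypothesis dis : forall i j, i != j -> forall p, lform (v i) p < 0 -> lform (v j) p < 0 -> False.
Hypothesis V3 : (2 < #|V|)%N.
Implicit Types (i j k : V) (s : seq V) (p q x y : T).

Lemma rK i : involutive (r i). Proof. exact: mirrorK (rv i) (v1 i). Qed.

Lemma r_continuous i : continuous (r i). Proof. exact: continuous_mirror (rv i) (v1 i). Qed.

Lemma r_le0 i p : (lform (v i) (r i p) <= 0) = (0 <= lform (v i) p).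
Proof.
by rewrite -(pmulr_lle0 _ (lfactor_gt0 p (v1 i))) (lform_mirror_self _ (rv i)) // oppr_le0.
Qed.

Lemma r_lt0 i p : (lform (v i) (r i p) < 0) = (0 < lform (v i) p).
Proof.
by rewrite -(pmulr_llt0 _ (lfactor_gt0 p (v1 i))) (lform_mirror_self _ (rv i)) // oppr_lt0.
Qed.

Lemma closed_outside i j p : i != j -> lform (v i) p <= 0 -> 0 <= lform (v j) p.
Proof.
move=> ij; rewrite le_eqVlt => /predU1P[|h].
  exact: (disjoint_on_circle (v1 i) (v1 j) (dis ij)).
exact: (disjoint_ge0 (dis ij)).
Qed.

Lemma open_outside i j p : i != j -> lform (v i) p < 0 -> 0 < lform (v j) p.
Proof.
move=> ij h; rewrite lt0r (closed_outside ij (ltW h)) andbT.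
apply: contraTneq h => pj; rewrite -leNgt.
by apply: (@closed_outside j i); rewrite ?pj // eq_sym.
Qed.

(** The union of the discs [r_{i_1} ... r_{i_n} D_j] over the reduced words
    [i_1 ... i_n j] of length [n + 1] that start with [i]. *)
Fixpoint piece n i : set T :=
  if n is m.+1 then r i @` (\bigcup_(j in [set j | j != i]) piece m j) else disc (v i).

Lemma closed_piece n i : closed (piece n i).
Proof.
elim: n i => [|n IH] i /=; first exact: closed_lform.
have -> : r i @` (\bigcup_(j in [set j | j != i]) piece n j) =
   r i @^-1` (\bigcup_(j in [set j | j != i]) piece n j).
  apply/seteqP; split=> [_ [p pj <-]|p pj]; first by rewrite /= rK.
  by exists (r i p) => //; rewrite rK.
have /continuous_closedP h := @r_continuous i; apply: h.
by apply: closed_bigcup => [|j _]; [exact: finite_finset|exact: IH].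
Qed.

Lemma piece_disc n i : piece n i `<=` disc (v i).
Proof.
elim: n i => [|n IH] i //= _ [p [j /= ji /IH pj] <-].
by rewrite /disc /= r_le0; apply: closed_outside pj.
Qed.

Lemma piece_decr n i : piece n.+1 i `<=` piece n i.
Proof.
elim: n i => [|n IH] i; first exact: piece_disc.
by apply: image_subset => p [j ji /IH pj]; exists j.
Qed.

Lemma piece_mono m n i : (m <= n)%N -> piece n i `<=` piece m i.
Proof.
elim: n => [|n IH]; first by rewrite leqn0 => /eqP ->.
rewrite leq_eqVlt => /predU1P[->//|/IH h].
exact: subset_trans (@piece_decr n i) h.
Qed.

Definition level n : set T := \bigcup_(i in [set: V]) piece n i.

Lemma closed_level n : closed (level n).
Proof. by apply: closed_bigcup => [|i _]; [exact: finite_finset|exact: closed_piece]. Qed.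

Definition core : set T := \bigcap_(n in [set: nat]) level n.

(** The vector of the disc of the word [i :: s]. *)
Fixpoint word_vec i s := if s is j :: s' then lrefl (v i) (word_vec j s') else v i.

Local Notation reduced := (path (fun a b : V => a != b)).

Lemma word_vec_unit i s : ldot (word_vec i s) (word_vec i s) = 1.
Proof.
elim: s i => [|j s IH] i //=.
by rewrite /lrefl ldot_combr !ldot_combl v1 IH (ldotC (word_vec j s)); ring.
Qed.

Lemma v_ldot i j : i != j -> ldot (v i) (v j) <= -1.
Proof. by move=> ij; exact: disjoint_ldot (dis ij). Qed.

(** The first inequality is what lets a further letter lengthen the vector of the word.
    When [j] is the second letter of the word, it does not follow from the same
    inequality for the tail, which starts with [j]; the second one covers this case. *)
Lemma word_vec_ldot i s : reduced i s -> forall j, j != i ->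
  ldot (v j) (word_vec i s) <= -1 /\ ldot (v i) (word_vec i s) + ldot (v j) (word_vec i s) <= 0.
Proof.
elim: s i => [|k s IH] i /=; first by move=> _ j ji; rewrite v1; have := v_ldot ji; split; lra.
move=> /andP[ik red] j ji; have [hi hki] := IH _ red _ ik.
have di := v_ldot ji.
rewrite !ldot_combr v1.
set Di := ldot (v i) (word_vec k s) in hi hki *; set d := ldot (v j) (v i) in di *.
have h : Di * d >= - Di by nra.
have [jk|jk] := eqVneq j k.
  by rewrite jk; move: hki; set Dk := ldot (v k) (word_vec k s) => hki; split; nra.
have [hj _] := IH _ red _ jk; set Dj := ldot (v j) (word_vec k s) in hj *.
by split; nra.
Qed.

Lemma piece_word n i p : piece n i p ->
  exists s, [/\ size s = n, reduced i s & disc (word_vec i s) p].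
Proof.
elim: n i p => [|n IH] i p; first by exists [::].
move=> [q [j /= ji /IH [s [sn red qs]]] <-].
exists (j :: s); split=> /=; rewrite ?sn // ?red ?andbT 1?eq_sym //.
by rewrite (mirror_disc _ (rv i) (v1 i)); exists q.
Qed.

Lemma three_circles : exists a b c : V, [/\ a != b, a != c & b != c].
Proof.
have /card_gt2P [a [b [c [_ []]]]] := V3.
by move=> ab bc ca; exists a, b, c; split=> //; rewrite eq_sym.
Qed.

(** The three products between [v a], [v b], [v c] being at most [-1], their sum has square
    at most [3 - 6], and [w] is its opposite.  If the last coordinate of [w] were
    nonnegative, the sum of the three forms would be negative everywhere, and the three
    disjoint open discs would cover the sphere, which is connected. *)
Lemma height_exists : exists w : lorentz R, [/\ 0 < - lw w,
   lx w ^+ 2 + ly w ^+ 2 + lz w ^+ 2 <= lw w ^+ 2 &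
   forall i s, reduced i s -> (size s)%:R <= ldot (word_vec i s) w].
Proof.
have [a [b [c [ab ac bc]]]] := three_circles.
pose w := lcomb (-1) (v a) (-1) (lcomb 1 (v b) 1 (v c)).
have hab := v_ldot ab; have hac := v_ldot ac; have hbc := v_ldot bc.
have ww : ldot w w <= -3.
  rewrite /w !(ldot_combr, ldot_combl) !v1 (ldotC (v b) (v a)) (ldotC (v c)) (ldotC (v c) (v b)).
  lra.
have n2 : lx w ^+ 2 + ly w ^+ 2 + lz w ^+ 2 = ldot w w + lw w ^+ 2 by rewrite /ldot; ring.
have w0 : 0 < - lw w.
  rewrite ltNge; apply/negP => w0.
  have fw p : lform (v a) p + lform (v b) p + lform (v c) p < 0.
    have e : lform (v a) p + lform (v b) p + lform (v c) p = - lform w p.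
      by rewrite /w !lform_comb; ring.
    rewrite e oppr_lt0 /lform.
    have := cauchy3 (lx w) (ly w) (lz w) (sphx p) (sphy p) (sphz p).
    rewrite sphereE mulr1 n2; nra.
  have oa (i : V) : open (odisc (v i)) := @open_lform R (v i).
  have [pb pb0] := odisc_nonempty (v1 b).
  suff aT : odisc (v a) = setT by apply: (dis ab _ pb0); have : setT pb by []; rewrite -aT.
  apply: (@sphere_connected R); first exact: odisc_nonempty (v1 a).
    by exists (odisc (v a)); rewrite ?setTI.
  exists (~` (odisc (v b) `|` odisc (v c))); first by apply: open_closedC; exact: openU.
  rewrite setTI; apply/seteqP; split=> p /=.
    by move=> h [] h'; [exact: (dis ab h h')|exact: (dis ac h h')].
  rewrite /odisc /= => /not_orP[/negP + /negP]; rewrite -!leNgt => hb hc.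
  by have := fw p; lra.
exists w; split=> //; first by rewrite n2; lra.
have vw i : 1 <= ldot (v i) w.
  rewrite !ldot_combr.
  have h j : i != j -> ldot (v i) (v j) <= -1 := @v_ldot i j.
  have [ia|/h ha] := eqVneq i a; first by subst i; rewrite v1; lra.
  have [ib|/h hb] := eqVneq i b; first by subst i; rewrite v1; lra.
  have [ic|/h hc] := eqVneq i c; first by subst i; rewrite v1; lra.
  lra.
move=> i s; elim: s i => [|j s IH] i /=; first by move=> _; apply: le_trans (vw i).
move=> /andP[ij red]; rewrite ldot_combl; have [h _] := word_vec_ldot red ij.
by have := IH _ red; have := vw i; rewrite -natr1; nra.
Qed.

(** Write [u = (n, t)] and [w = (m, - t0)].  The product is [n.m + t t0], with
    [|n| = sqrt (1 + t^2) <= 1 + |t|] and [|m| <= t0], so [t < L] would make it less than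
    [t0 (2 L + 1)].  On the disc, where [n.x <= - t], one has
    [|x + n / t|^2 = 1 + 2 n.x / t + (1 + t^2) / t^2 <= 1 / t^2]. *)
Lemma small_disc (w u : lorentz R) (L M : R) p q : ldot u u = 1 -> 0 < - lw w ->
  lx w ^+ 2 + ly w ^+ 2 + lz w ^+ 2 <= lw w ^+ 2 -> 0 < L ->
  - lw w * (2 * L + 1) <= M -> M <= ldot u w -> disc u p -> disc u q ->
  chord p q <= 4 / L ^+ 2.
Proof.
move=> u1 w0 w2 L0 LM Mu pu qu.
set t0 := - lw w in w0 LM.
have nu : lx u ^+ 2 + ly u ^+ 2 + lz u ^+ 2 = 1 + lw u ^+ 2 by rewrite -u1 /ldot; ring.
have uL : L <= lw u.
  have := cauchy3 (lx u) (ly u) (lz u) (lx w) (ly w) (lz w).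
  rewrite nu; move: Mu; rewrite /ldot; set n := lx u * lx w + _ + _ => Mu h.
  have h2 : n ^+ 2 <= (1 + lw u ^+ 2) * t0 ^+ 2.
    by apply: le_trans h _; rewrite /t0 sqrrN ler_wpM2l // addr_ge0 ?sqr_ge0.
  have Mu' : M - lw u * t0 <= n by rewrite /t0; lra.
  have M0 : 0 < M by apply: lt_le_trans LM; rewrite mulr_gt0 //; lra.
  rewrite leNgt; apply/negP => uL.
  have h3 : lw u * t0 < M by nra.
  have h4 : (M - lw u * t0) ^+ 2 <= n ^+ 2 by rewrite -subr_ge0 subr_sqr mulr_ge0 //; lra.
  have h5 : M ^+ 2 - t0 ^+ 2 <= 2 * M * t0 * lw u by nra.
  have h6 : M * t0 * lw u < M * t0 * L by rewrite ltr_pM2l // mulr_gt0.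
  nra.
have t1 : 0 < lw u by lra.
have key x : disc u x -> (sphx x + lx u / lw u) ^+ 2 + (sphy x + ly u / lw u) ^+ 2
    + (sphz x + lz u / lw u) ^+ 2 <= (lw u)^-1 ^+ 2.
  rewrite /disc /= /lform => ux.
  rewrite (_ : _ + _ = (sphx x ^+ 2 + sphy x ^+ 2 + sphz x ^+ 2) +
   (lx u ^+ 2 + ly u ^+ 2 + lz u ^+ 2) / lw u ^+ 2 + 2 / lw u *
     (lx u * sphx x + ly u * sphy x + lz u * sphz x)); last by field; rewrite gt_eqF.
  rewrite sphereE nu.
  have : 2 / lw u * (lx u * sphx x + ly u * sphy x + lz u * sphz x) <= 2 / lw u * (- lw u).
    by apply: ler_wpM2l; [rewrite divr_ge0 // ltW|lra].
  have -> : 2 / lw u * (- lw u) = - 2 by field; rewrite gt_eqF.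
  have -> : (1 + lw u ^+ 2) / lw u ^+ 2 = (lw u)^-1 ^+ 2 + 1 by field; rewrite gt_eqF.
  lra.
have kp := key _ pu; have kq := key _ qu.
have : chord p q <= 4 * (lw u)^-1 ^+ 2.
  have par (a b c : R) : (a - b) ^+ 2 <= 2 * (a + c) ^+ 2 + 2 * (b + c) ^+ 2.
    by rewrite -subr_ge0 (_ : _ - _ = (a + b + 2 * c) ^+ 2) ?sqr_ge0 //; ring.
  have := par (sphx p) (sphx q) (lx u / lw u); have := par (sphy p) (sphy q) (ly u / lw u).
  have := par (sphz p) (sphz q) (lz u / lw u); rewrite /chord => hz hy hx; lra.
move/le_trans; apply; rewrite exprVn ler_wpM2l // lef_pV2 ?posrE ?exprn_gt0 //.
by rewrite -subr_ge0 subr_sqr mulr_ge0 //; lra.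
Qed.

Lemma shrink (e : R) : 0 < e -> exists N : nat, forall i s p q, reduced i s ->
  (N <= size s)%N -> disc (word_vec i s) p -> disc (word_vec i s) q -> chord p q < e.
Proof.
move=> e0; have [w [w0 w2 hw]] := height_exists.
(* Then [L^2 >= L > 4 / e]. *)
pose L := 1 + 4 / e.
have e4 : 0 < 4 / e by rewrite divr_gt0.
exists (Num.bound (- lw w * (2 * L + 1))) => i s p q red Ns ps qs.
apply: (@le_lt_trans _ _ (4 / L ^+ 2)).
  apply: (small_disc (word_vec_unit i s) w0 w2 _ _ (hw _ _ red) ps qs); first by rewrite /L; lra.
  apply: ltW; apply: lt_le_trans (archi_boundP _) _.
    by rewrite mulr_ge0 ?ltW // /L; lra.
  by rewrite ler_nat.
have L0 : 0 < L ^+ 2 by rewrite exprn_gt0 // /L; lra.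
rewrite ltr_pdivrMr // -ltr_pdivrMl // mulrC /L; nra.
Qed.
End Packing.

(** * The limit set *)
Section Orbits.
Variables (R : realType) (V : finType).
Local Notation T := (riemann_sphere R).
Variables (v : V -> lorentz R) (r : V -> T -> T).
Hypotheses (v1 : forall i, ldot (v i) (v i) = 1) (rv : forall i, mirrors (v i) (r i)).
Hypothesis dis : forall i j, i != j -> forall p, lform (v i) p < 0 -> lform (v j) p < 0 -> False.
Hypothesis V3 : (2 < #|V|)%N.
Implicit Types (i j k : V) (s : seq V) (p q x y : T).
Local Notation reduced := (path (fun a b : V => a != b)).
Local Notation rK := (rK v1 rv).
Local Notation piece := (piece v r).
Local Notation level := (level v r).
Local Notation core := (core v r).

Definition word_orbit y : set T := range (foldr r y).

Lemma foldr_inj s : injective (fun y => foldr r y s).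
Proof. by elim: s => [|i s IH] x y //= /(can_inj (rK i)) /IH. Qed.

(** The last reflection moves [y] into its disc, and the others follow the word. *)
Lemma word_disc i s y : 0 <= lform (v (last i s)) y ->
  disc (word_vec v i s) (foldr r y (i :: s)).
Proof.
elim: s i => [|j s IH] i /= h; first by rewrite /disc /= (r_le0 v1 rv).
by rewrite (mirror_disc _ (rv i) (v1 i)); exists (foldr r y (j :: s)) => //; exact: IH.
Qed.

Lemma avoid_two i j : exists k, k != i /\ k != j.
Proof.
have /card_gt2P [a [b [c [_ [ab bc ca]]]]] := V3.
have [ai|ai] := eqVneq a i; have [aj|aj] := eqVneq a j; try by exists a.
- by exists b; rewrite -{1}ai -aj eq_sym ab.
- have [bj|bj] := eqVneq b j; last by exists b; rewrite -ai eq_sym.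
  by exists c; rewrite -ai -bj ca eq_sym.
- have [bi|bi] := eqVneq b i; last by exists b; rewrite -aj (eq_sym b a).
  by exists c; rewrite -aj -bi ca eq_sym.
Qed.

(** Take [y] inside a disc [D_a]: then every open disc of the packing contains a point of
    the orbit, [y] itself or its image under one reflection.  A word sends the points
    chosen in two discs other than that of its last letter to two distinct points of the
    disc of the word; if this disc is a small one around [x], one of them differs from
    [x]. *)
Lemma core_sub_limit : exists y, core `<=` limit_point (word_orbit y).
Proof.
have /card_gt0P [a _] : (0 < #|V|)%N by apply: leq_ltn_trans V3.
have [y ya] := odisc_nonempty (v1 a); exists y => x xK U /nbhs_chord [e e0 eU].
have [N hN] := shrink v1 dis V3 e0.
have [i _ /(piece_word v1 rv) [s [sN red xs]]] := xK N I.
have z j : exists s', odisc (v j) (foldr r y s').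
  have [->|ja] := eqVneq j a; first by exists [::].
  exists [:: j]; rewrite /odisc /= (r_lt0 v1 rv).
  by apply: (open_outside v1 dis _ ya); rewrite eq_sym.
pose l := last i s.
have [j [jl _]] := avoid_two l l; have [k [kl kj]] := avoid_two l j.
have [sj hj] := z j; have [sk hk] := z k.
have inU m sm : m != l -> odisc (v m) (foldr r y sm) ->
    U (foldr r (foldr r y sm) (i :: s)).
  move=> ml hm; apply: eU; apply: (hN i s) => //; first by rewrite sN.
  by apply: word_disc; apply: (closed_outside v1 dis ml); exact: ltW.
have neq : foldr r (foldr r y sj) (i :: s) <> foldr r (foldr r y sk) (i :: s).
  move=> /foldr_inj eqs; rewrite eqs in hj.
  exact: (dis kj hk hj).
have [xj|xj] := eqVneq (foldr r (foldr r y sj) (i :: s)) x.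
  exists (foldr r (foldr r y sk) (i :: s)); split; last exact: inU hk.
    by apply/eqP => eqs; apply: neq; rewrite xj eqs.
  by exists ((i :: s) ++ sk); rewrite // foldr_cat.
exists (foldr r (foldr r y sj) (i :: s)); split => //; last exact: inU hj.
by exists ((i :: s) ++ sj); rewrite // foldr_cat.
Qed.

Lemma reduce_word s : exists2 s', sorted (fun a b : V => a != b) s' &
  forall y, foldr r y s = foldr r y s'.
Proof.
elim: s => [|i s [s' red e]]; first by exists [::].
case: s' red e => [|j t] red e; first by exists [:: i] => // y; rewrite /= e.
have [ij|ij] := eqVneq i j; last by exists [:: i, j & t] => [|y]; rewrite /= ?ij ?e.
exists t; first exact: path_sorted red.
by move=> y; rewrite /= e /= ij rK.
Qed.

Definition outside y := forall i, 0 <= lform (v i) y.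

Lemma word_piece i s y : reduced i s -> outside y -> piece (size s) i (foldr r y (i :: s)).
Proof.
elim: s i => [|j s IH] i /=; first by move=> _ h; rewrite /disc /= (r_le0 v1 rv).
move=> /andP[ij red] h; exists (foldr r y (j :: s)) => //.
by exists j; [rewrite /= eq_sym|exact: IH].
Qed.

(** The successive discs visited by [y], [r_i y], ... form a reduced word, since the
    reflection in [D_i] moves its interior outside. *)
Lemma never_outside y : (forall s, ~ outside (foldr r y s)) ->
  forall n, exists2 i, piece n i y & lform (v i) y < 0.
Proof.
move=> h n; elim: n y h => [|n IH] y h.
  have /existsNP [i /negP] := h [::]; rewrite -ltNge => yi.
  by exists i => //=; exact: ltW.
have /existsNP [i /negP] := h [::]; rewrite -ltNge => yi.
have [s|j pj yj] := IH (r i y).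
  by have := h (rcons s i); rewrite foldr_rcons.
exists i => //; exists (r i y); last by rewrite rK.
exists j => //=; apply: contraTneq yj => ->.
by rewrite (r_lt0 v1 rv) -leNgt ltW.
Qed.

(** If the orbit has a point outside all the open discs, reduced words of more than [n]
    letters carry this point into [level n], so that only finitely many points of the
    orbit are outside; otherwise the whole orbit is in [level n]. *)
Lemma limit_sub_core y : limit_point (word_orbit y) `<=` core.
Proof.
move=> x xl n _; have cK := closed_level v1 rv (n := n).
have [[u hu]|/forallNP hu] := pselect (exists s, outside (foldr r y s)); last first.
  apply: cK; apply: closure_subset (subset_limit_point xl) => _ [s _ <-].
  have [|i pi _] := @never_outside (foldr r y s) _ n; last by exists i.
  by move=> s'; rewrite -foldr_cat; exact: hu.
apply: contrapT => nx.
pose E := [set foldr r (foldr r y u) s | s in [set s | (size s <= n)%N]].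
have finE : finite_set E.
  apply: (@sub_finite_set _ _ [set foldr r (foldr r y u) (b) | b in [set: n.-bseq V]]).
    by move=> _ [s /= sn <-]; exists (Bseq sn).
  by apply: finite_image; exact: finite_finset.
have cE : closed (E `\ x).
  have /accessible_finite_set_closed h := hausdorff_accessible (@sphere_hausdorff R).
  by apply: h; apply: sub_finite_set finE; exact: subDsetl.
have nb : nbhs x (~` level n `&` ~` (E `\ x)).
  apply: open_nbhs_nbhs; split; first by apply: openI; exact: closed_openC.
  by split=> // -[_ /(_ erefl)].
have [z [zx [s _ sz] [zK zE]]] := xl _ nb.
have [s' red e] := reduce_word (s ++ rev u).
have yE : y = foldr r (foldr r y u) (rev u).
  elim: (u) => //= i t IH; rewrite rev_cons foldr_rcons rK //.
have {}sz : foldr r (foldr r y u) s' = z by rewrite -e foldr_cat -yE.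
have [sn|sn] := leqP (size s') n.
  by apply: zE; split; [exists s'|exact/eqP].
case: s' red sz sn {e} => [|i t] //= red sz sn; apply: zK.
exists i => //; apply: (piece_mono v1 rv dis (n := size t)) => //.
by rewrite -sz; exact: word_piece.
Qed.
End Orbits.

(** * Nested and chained connected sets *)

(** The sets form the basis of a filter, and its cluster points lie in all of them. *)
Lemma nested_nonempty (T : topologicalType) (F : nat -> set T) :
  compact [set: T] -> (forall n, closed (F n)) -> (forall n, F n.+1 `<=` F n) ->
  (forall n, F n !=set0) -> \bigcap_n F n !=set0.
Proof.
move=> cT cF dF nF.
have mF m n : (m <= n)%N -> F n `<=` F m.
  elim: n => [|n IH]; first by rewrite leqn0 => /eqP ->.
  rewrite leq_eqVlt => /predU1P[->//|/IH h]; exact: subset_trans (dF n) h.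
have FF : ProperFilter (filter_from [set: nat] F).
  apply: filter_from_proper; last by move=> n _; exact: nF.
  apply: filter_from_filter; first by exists 0%N.
  move=> m n _ _; exists (maxn m n) => // x Fx.
  by split; apply: mF Fx; rewrite ?leq_maxl ?leq_maxr.
have [|p [_ pF]] := cT _ FF; first by exists 0%N.
exists p => n _; apply: cF => U nU.
by apply: pF => //; exists n.
Qed.

(** A splitting of the intersection into closed sets extends to disjoint open sets, by
    normality; by compactness these open sets cover some [F n] already, and split it. *)
Lemma nested_connected (R : realType) (T : topologicalType) (F : nat -> set T) :
  hausdorff_space T -> compact [set: T] -> (forall n, closed (F n)) ->
  (forall n, F n.+1 `<=` F n) -> (forall n, connected (F n)) ->
  connected (\bigcap_n F n).
Proof.
move=> hT cT cF dF kF B B0 [C oC BC] [D cD BD].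
set A := \bigcap_n F n in BC BD *.
have cA : closed A by apply: closed_bigI => n _; exact: cF.
have cB : closed B by rewrite BD; exact: closedI.
pose B' := A `&` ~` C.
have cB' : closed B' by apply: closedI => //; exact: open_closedC.
have BB' : B `&` B' = set0.
  by rewrite BC; apply/seteqP; split=> // p [[_ pC] [_ /(_ pC)]].
have [U [W [oU oW BU BW UW]]] := (@normal_openP R T).1 (compact_normal hT cT) _ _ cB cB' BB'.
apply/seteqP; split; first by rewrite BC; exact: subIsetl.
move=> p Ap; rewrite BC; split=> //; apply: contrapT => pC.
have pW : W p by apply: BW.
have [n Fn] : exists n, F n `<=` U `|` W.
  apply/not_existsP => h.
  have [||m|q qF] := @nested_nonempty T (fun n => F n `&` ~` (U `|` W)) cT.
  - by move=> m; apply: closedI => //; apply: open_closedC; exact: openU.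
  - by move=> m q [qF qU]; split => //; exact: dF.
  - have := h m; rewrite /subset -existsNP => -[q /not_implyP[? ?]].
    by exists q.
  have Aq : A q by move=> m _; have [] := qF m I.
  have [_ nUW] := qF 0%N I; apply: nUW.
  have [qC|qC] := pselect (C q); first by left; apply: BU; rewrite BC.
  by right; apply: BW.
have AF : A `<=` F n by move=> q /(_ n I).
have e : F n `&` U = F n.
  apply: (kF n).
  - by have [q qB] := B0; exists q; split; [apply: AF; move: qB; rewrite BC => -[]|exact: BU].
  - by exists U.
  - exists (~` W); first exact: open_closedC.
    apply/seteqP; split=> q [qF qU]; split=> //.
      by move=> qW; have : set0 q by rewrite -UW.
    by have [] := Fn _ qF.
have [_ pU] : (F n `&` U) p by rewrite e; exact: AF.
by have : set0 p by rewrite -UW.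
Qed.

(** The union of the sets along a walk is connected; all walks start from one vertex. *)
Lemma graph_bigcup_connected (T : topologicalType) (V : finType) (e : rel V)
    (S : {set V}) (A : V -> set T) :
  (forall i, i \in S -> A i !=set0) -> (forall i, i \in S -> connected (A i)) ->
  (forall i j, i \in S -> j \in S -> e i j -> A i `&` A j !=set0) ->
  {in S &, forall x y, connect [rel u v in S | e u v] x y} ->
  connected (\bigcup_(i in [set` S]) A i).
Proof.
move=> A0 cA eA cS.
have [i0 i0S|/= S0] := pickP (mem S); last first.
  rewrite (_ : \bigcup_(i in _) _ = set0); first exact: connected0.
  by apply/seteqP; split=> // p [i /= iS]; have := S0 i; rewrite /= iS.
have path_good x p : x \in S -> path [rel u v in S | e u v] x p ->
  exists B, [/\ connected B, A x `<=` B, A (last x p) `<=` B & B `<=` \bigcup_(i in [set` S]) A i].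
  elim: p x => [|y p IH] x xS /=.
    by move=> _; exists (A x); split=> //; [exact: cA|move=> q qx; exists x].
  move=> /andP[/andP[/andP[_ yS] exy] /(IH _ yS) [B [cB yB lB BS]]].
  exists (A x `|` B); split.
  - apply: connectedU => //; last exact: cA.
    by have [q [qx qy]] := eA _ _ xS yS exy; exists q; split=> //; exact: yB.
  - by left.
  - by move=> q ql; right; exact: lB.
  - by move=> q [qx|/BS//]; exists x.
have goodP i : i \in S -> exists B,
    [/\ connected B, A i0 `<=` B, A i `<=` B & B `<=` \bigcup_(i in [set` S]) A i].
  move=> iS; have /connectP [p pp ->] := cS _ _ i0S iS.
  exact: path_good.
have /choice [B hB] : forall i, exists B, i \in S ->
    [/\ connected B, A i0 `<=` B, A i `<=` B & B `<=` \bigcup_(i in [set` S]) A i].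
  move=> i; have [/goodP [B hB]|/negP iS] := boolP (i \in S); first by exists B.
  by exists set0.
have -> : \bigcup_(i in [set` S]) A i = \bigcup_(i in [set` S]) B i.
  apply/seteqP; split=> p [i iS pi].
    by exists i => //; have [_ _ h _] := hB _ iS; exact: h.
  by have [_ _ _ h] := hB _ iS; exact: h.
apply: bigcup_connected.
  have [q qi] := A0 _ i0S; exists q => i iS.
  by have [_ h _ _] := hB _ iS; exact: h.
by move=> i iS; have [] := hB _ iS.
Qed.

(** * The contact graph and the limit set *)
Section Main.
Variables (R : realType) (V : finType).
Local Notation T := (riemann_sphere R).
Variables (v : V -> lorentz R) (r : V -> T -> T).
Hypotheses (v1 : forall i, ldot (v i) (v i) = 1) (rv : forall i, mirrors (v i) (r i)).
Hypothesis dis : forall i j, i != j -> forall p, lform (v i) p < 0 -> lform (v j) p < 0 -> False.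
Hypothesis V3 : (2 < #|V|)%N.
Implicit Types (i j k : V) (s : seq V) (p q x y : T).
Local Notation rK := (rK v1 rv).
Local Notation piece := (piece v r).
Local Notation level := (level v r).
Local Notation core := (core v r).

Definition touching i j := (i != j) && `[< exists p, lform (v i) p = 0 /\ lform (v j) p = 0 >].

Lemma piece_nonempty n i : piece n i !=set0.
Proof.
elim: n i => [|n IH] i /=.
  by have [p] := odisc_nonempty (v1 i); exists p; exact: ltW.
have [j [ji _]] := avoid_two V3 i i; have [p pj] := IH j.
by exists (r i p); exists p => //; exists j.
Qed.

(** Both reflections fix a tangency point, so it stays in both pieces at each step. *)
Lemma tangency_piece n i j p : i != j -> lform (v i) p = 0 -> lform (v j) p = 0 ->
  piece n i p /\ piece n j p.
Proof.
move=> ij pi pj; elim: n => [|n [hi hj]] /=; first by rewrite /disc /= pi pj.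
split; exists p; rewrite ?(mirror_fix (rv _)) //.
  by exists j; rewrite //= eq_sym.
by exists i.
Qed.

Lemma touching_meet n i j : touching i j -> piece n i `&` piece n j !=set0.
Proof.
by move=> /andP[ij /asboolP [p [pi pj]]]; exists p; exact: (tangency_piece n ij pi pj).
Qed.

(** Deleting [i] from the graph gives the connectedness of the union that [r_i] maps onto
    [piece n.+1 i]; for a whole level, two vertices are joined in the graph without a
    third one. *)
Lemma core_connected : k_connected 2 touching -> connected core.
Proof.
move=> [_ hk].
have cp n i : connected (piece n i).
  elim: n i => [|n IH] i; first exact: disc_connected (v1 i).
  apply: connected_continuous_connected; last exact/continuous_subspaceT/(r_continuous v1 rv).
  rewrite (_ : [set j | j != i] = [set` ~: [set i]%SET]); last first.
    by apply/seteqP; split=> j /=; rewrite !inE.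
  apply: (@graph_bigcup_connected _ _ touching) => //.
  - by move=> j _; exact: piece_nonempty.
  - by move=> j k _ _; exact: touching_meet.
  - by apply: hk; rewrite cards1.
have cl n : connected (level n).
  rewrite /level (_ : [set: V] = [set` [set: V]%SET]); last first.
    by apply/seteqP; split=> j //=; rewrite !inE.
  apply: (@graph_bigcup_connected _ _ touching) => //.
  - by move=> j _; exact: piece_nonempty.
  - by move=> j k _ _; exact: touching_meet.
  - move=> x y _ _; have [c [cx cy]] := avoid_two V3 x y.
    have := hk [set c]%SET; rewrite cards1 => /(_ erefl x y).
    rewrite !inE eq_sym cx eq_sym cy => /(_ erefl erefl).
    apply: connect_sub => {cx cy} a b /= /andP[_ eab].
    by apply: connect1; rewrite /= !inE.
apply: (@nested_connected R).
- exact: sphere_hausdorff.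
- exact: one_point_compactification_compact.
- by move=> n; exact: closed_level.
- by move=> n p [i _ /(piece_decr v1 rv dis) pi]; exists i.
- exact: cl.
Qed.

Lemma core_meets i : core `&` disc (v i) !=set0.
Proof.
have [|n|n|n|p pi] := @nested_nonempty T (piece^~ i).
- exact: one_point_compactification_compact.
- exact: closed_piece.
- exact: piece_decr.
- exact: piece_nonempty.
exists p; split; last exact: (pi 0%N I).
by move=> n _; exists i => //; exact: pi.
Qed.

Let discs (a : pred V) : set T := \bigcup_(j in [set j | a j]) disc (v j).

Let closed_discs a : closed (discs a).
Proof. by apply: closed_bigcup => [|j _]; [exact: finite_finset|exact: closed_lform]. Qed.

(** A point of [D_i] and of [r_c D_j] is both outside and inside the circle [c], hence on
    it and fixed by [r_c]; so it would be in [D_i] and [D_j], which do not meet. *)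
Lemma separated_discs (c : V) (a b : pred V) : ~~ a c -> ~~ b c ->
  (forall i j, a i -> b j -> i != j) ->
  (forall i j, a i -> b j -> ~~ touching i j) ->
  (discs a `|` r c @` discs a) `&` (discs b `|` r c @` discs b) = set0.
Proof.
move=> ac bc nab tab.
have XX (p : T) : discs a p -> discs b p -> False.
  move=> [i /= ai pi] [j /= bj pj]; have ij := nab _ _ ai bj.
  have /negP := tab _ _ ai bj; apply; rewrite /touching ij /=.
  apply/asboolP; exists p; split; apply/eqP; rewrite eq_le; apply/andP; split=> //.
    by apply: (closed_outside v1 dis _ pj); rewrite eq_sym.
  exact: (closed_outside v1 dis ij pi).
have fixed (d d' : pred V) q : ~~ d c -> ~~ d' c -> discs d q -> discs d' (r c q) -> r c q = q.
  move=> dc d'c [i /= di qi] [j /= dj qj]; apply: (mirror_fix (rv c)).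
  have ic : i != c by apply: contraNneq dc => <-.
  have jc : j != c by apply: contraNneq d'c => <-.
  apply/eqP; rewrite eq_le (closed_outside v1 dis ic qi) andbT.
  by rewrite -{1}(rK c q) (r_le0 v1 rv) (closed_outside v1 dis jc qj).
apply/seteqP; split=> // p [[pa|[q qa qp]] [pb|[q' qb qp']]].
- exact: XX pa pb.
- move: pa; rewrite -qp' => pa; apply: (XX q' _ qb).
  by rewrite -(fixed b a _ bc ac qb pa).
- move: pb; rewrite -qp => pb; apply: (XX q qa).
  by rewrite -(fixed a b _ ac bc qa pb).
- by apply: (XX q qa); rewrite -(can_inj (rK c) (etrans qp' (esym qp))).
Qed.

(** If [y] cannot be reached from [x] without passing through [c], the vertices reached
    from [x] and the others form two classes as in [separated_discs]. *)
Lemma two_connected_of_core : connected core -> k_connected 2 touching.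
Proof.
move=> kc; split=> // S /eqP/cards1P [c ->] x y; rewrite !inE => xc yc.
apply: contrapT => /negP nxy.
pose e : rel V := [rel u w in ~: [set c]%SET | touching u w].
pose a : pred V := connect e x; pose b : pred V := [pred j | (j != c) && ~~ a j].
have ac : ~~ a c.
  apply/negP => /connectP [p]; elim/last_ind: p => [_ /= cx|p z _]; first by rewrite cx eqxx in xc.
  by rewrite rcons_path last_rcons /e /= => /andP[_ /andP[/andP[_ +] _]] e'; rewrite -e' !inE eqxx.
have bc : ~~ b c by rewrite /b /= eqxx.
have nab i j : a i -> b j -> i != j.
  by move=> ai /andP[_]; apply: contraNneq => <-.
have tab i j : a i -> b j -> ~~ touching i j.
  move=> ai /andP[jc]; apply: contraNN => tij; apply: connect_trans (ai) _.
  apply: connect1; rewrite /e /= !inE jc tij !andbT.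
  by apply: contraNneq ac => <-.
have := separated_discs ac bc nab tab; set U := (_ `|` _); set W := (_ `|` _) => UW.
have rclosed d : closed (r c @` discs d).
  have -> : r c @` discs d = r c @^-1` discs d.
    apply/seteqP; split=> [_ [p pj <-]|p pj]; first by rewrite /= rK.
    by exists (r c p) => //; rewrite rK.
  by have /continuous_closedP h := @r_continuous _ _ _ _ v1 rv c; apply: h; exact: closed_discs.
have cU : closed U by exact: closedU.
have cW : closed W by exact: closedU.
(* Each disc of a word of length 2 starts with [c], and is the image of a disc in one of the
   two classes, or lies in the disc of its first letter. *)
have cover : core `<=` U `|` W.
  move=> p /(_ 1%N I) [i _]; have [->|ic] := eqVneq i c.
    move=> [q [j /= jc qj] <-]; have [aj|aj] := boolP (a j).
      by left; right; exists q => //; exists j.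
    by right; right; exists q => //; exists j => //; apply/andP.
  move=> /(piece_disc v1 rv dis) pi; have [ai|ai] := boolP (a i).
    by left; left; exists i.
  by right; left; exists i => //; apply/andP.
have e' : core `&` U = core.
  apply: kc.
  - have [p [pc px]] := core_meets x; exists p; split=> //; left; exists x => //.
    exact: connect0.
  - exists (~` W); first exact: closed_openC.
    apply/seteqP; split=> q [qF qU]; split=> //.
      by move=> qW; have : set0 q by rewrite -UW.
    by have [] := cover _ qF.
  - by exists U.
have [p [pc py]] := core_meets y.
have [_ pU] : (core `&` U) p by rewrite e'.
have : set0 p by rewrite -UW; split=> //; left; exists y => //; apply/andP.
by [].
Qed.
End Main.

(** Words in the reflections are closed under inversion, reflections being involutions. *)
Lemma kissing_orbit (R : realType) (V : finType) (P : V -> ocircle R) (y : riemann_sphere R) :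
  [set g y | g in kissing_reflection_group P] = word_orbit (fun i => reflection (P i)) y.
Proof.
have invol i : involutive (reflection (P i)).
  exact: mirrorK (mirrors_reflection (P i)) (ldot_unit (P i)).
apply/seteqP; split=> [_ [g gG <-]|_ [s _ <-]].
  pose W : set (riemann_sphere R -> riemann_sphere R) :=
     range (fun s => (foldr (fun i => reflection (P i)))^~ s).
  suff [s _ <-] : W g by exists s.
  apply: gG; split; last first.
    by move=> _ [i _ <-]; exists [:: i].
  split.
  - by exists [::].
  - move=> _ _ [s _ <-] [t _ <-]; exists (s ++ t) => //.
    by apply/funext => x; rewrite foldr_cat.
  - move=> _ [s _ <-]; exists ((foldr (fun i => reflection (P i)))^~ (rev s)); split.
    + by exists (rev s).
    + by move=> x; elim: s => //= i s IH; rewrite rev_cons foldr_rcons invol.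
    + move=> x; elim/last_ind: s x => //= s i IH x.
      by rewrite rev_rcons /= foldr_rcons invol IH.
exists ((foldr (fun i => reflection (P i)))^~ s) => //.
elim: s => [|i s IH]; first by move=> A [[]].
move=> A hA; have [[_ hc _] hg] := hA.
have := hc (reflection (P i)) _ _ (IH A hA); apply.
by apply: hg; exists i.
Qed.

Theorem proposition3p4 (R : realType) (V : finType) (P : V -> ocircle R)
    (packP : circle_packing P) :
  connected (limit_set (kissing_reflection_group P)) <->
  k_connected 2 (contact_graph P).
Proof.
have [V3 _ /trivIsetP tP] := packP.
pose v i := oc_unit (P i); pose r i := reflection (P i).
have v1 i : ldot (v i) (v i) = 1 by exact: ldot_unit.
have rv i : mirrors (v i) (r i) by exact: mirrors_reflection.
have dis i j : i != j -> forall p, lform (v i) p < 0 -> lform (v j) p < 0 -> False.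
  move=> ij p pi pj; have := tP _ _ I I ij.
  by move/seteqP => [/(_ p) h _]; apply: h; rewrite /setI /= !oc_interiorE.
have -> : limit_set (kissing_reflection_group P) = core v r.
  apply/seteqP; split=> [p [y _]|].
    by rewrite kissing_orbit; exact: limit_sub_core.
  have [y hy] := core_sub_limit v1 rv dis V3.
  by move=> p /hy; exists y => //; rewrite kissing_orbit.
have -> : contact_graph P = touching v :> rel V.
  apply/funext => i; apply/funext => j; rewrite /contact_graph /touching /=.
  congr andb; apply: asbool_equiv_eq.
  by split=> -[p [pi pj]]; exists p; split; apply/oc_circleE.
split; first exact: two_connected_of_core.
exact: core_connected.
Qed.
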